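(* In the setting described in the context, let $S:\Theta\to 2^H$ be any solution concept nested into $S_R$, i.e. $S(\theta)\subseteq S_R(\theta)$ for all $\theta\in\Theta$, and let $\Psi_R\subseteq\Theta\times H$ be the set of pairs $(\theta,h)$ satisfying Assumptions A1–A4 below. Then $S$ is discernible relative to $\Psi_R$.
   Context: Players $I=\{1,\dots,d_I\}$, $2\le d_I<\infty$, each choose $y_i\in\{0,1\}$; $Y=\{0,1\}^{d_I}$, $y_{-i}=(y_j)_{j\ne i}$. There is a random vector $(\mathbf z,\mathbf w,\mathbf e,\mathbf y)$: $\mathbf w$ has support $W\subseteq\mathbb R^{d_W}$, $\mathbf z=(\mathbf z_i)_{i\in I}\in\mathbb R^{d_I}$, $\mathbf x=(\mathbf z,\mathbf w)$ (values in $X$) observed covariates, $\mathbf e\in\mathbb R^{d_I}$ unobserved payoff shocks, $\mathbf y\in Y$ observed outcome; the distribution of $\mathbf x$ is fixed. A parameter is $\theta=(\alpha,\beta,\Sigma)$ with measurable $\alpha_{i,y_{-i}}:W\to\mathbb R$, $\beta_i:W\to\mathbb R$, $\Sigma:W\to\mathbb R^{d_I\times d_I}$; $\Theta$ is the set of parameters. Given $\theta$ and $(x,e)$, $x=(z,w)$, the players play the simultaneous-move complete-information game with payoffs $\pi_{i,y}(x,e,\theta)=y_i(\alpha_{i,y_{-i}}(w)+\beta_i(w)z_i-e_i)$. A distribution of play is a measurable $h:Y\times X\times\mathbb R^{d_I}\to[0,1]$ with $\sum_y h(y,x,e)=1$; $H$ is the set of these; $h=h'$ means $h(\mathbf x,\mathbf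 e)=h'(\mathbf x,\mathbf e)$ a.s. $\mathbb E[h(\mathbf x,\mathbf e)\mid\mathbf x;\theta]$ denotes the expectation of $h(\mathbf x,\mathbf e)=(h(y,\mathbf x,\mathbf e))_{y\in Y}$ with respect to the conditional law $N(0,\Sigma(\mathbf w))$ of $\mathbf e$ given $\mathbf x$ implied by $\theta$. A solution concept is a map $S:\Theta\to2^H$. $S_R(\theta)$ is the set of $h\in H$ such that for all $x,e$, $h(x,e)$ puts positive probability only on rationalizable outcomes (profiles of actions surviving iterated elimination of strictly dominated strategies) of the game with payoffs $\pi(x,e,\theta)$. Discernibility: given $\Psi\subseteq\Theta\times H$, $S$ is discernible relative to $\Psi$ if there do not exist $(\theta,h),(\theta',h')\in\Psi$ with $h\in S(\theta)$, $h'\notin S(\theta')$ and $\mathbb E[h(\mathbf x,\mathbf e)\mid\mathbf x;\theta]=\mathbb E[h'(\mathbf x,\mathbf e)\mid\mathbf x;\theta']$ almost surely. Assumptions on a pair $(\theta,h)$: (A1) for all $w\in W$ the support of $\mathbf z$ given $\mathbf w=w$ is $\mathbb R^{d_I}$, and $\beta_i(w)\ne0$ for all $i,w$; (A2) $\mathbf e\mid(\mathbf z=z,\mathbf w=w)\sim N(0,\Sigma(w))$ for all $z,w$, with $\Sigma(w)$ symmetric positive definite and $\Sigma_{ii}(w)=1$; (A3) there is a measurable $\tilde h$ with $h(\mathbf x,\mathbf e)=\tilde h(\mathbf w,\mathbf v)$ a.s., where $\mathbf v_i=\beta_i(\mathbf w)\mathbf z_i-\mathbf e_i$; (A4) $h\in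 S_R(\theta)$.
   Formalization: The solution concept S is assumed not to distinguish parameters θ that agree for almost every w (nor h that agree a.s.), and nesting in S_R is read up to this identification; without invariance in θ the claim fails. *)

(* Defs.v *)
From HB Require Import structures.
From mathcomp Require Import all_boot all_order all_algebra.
From mathcomp Require Import all_classical all_reals all_analysis.
Set Implicit Arguments. Unset Strict Implicit. Unset Printing Implicit Defensive.
Import Order.TTheory GRing.Theory Num.Theory.
Local Open Scope classical_set_scope.
Local Open Scope ring_scope.

(* Basic objects.  Players are 'I_dI, action profiles are Y = {0,1}^dI      *)
(* (true = 1).  Points of R^k are k.-tuples (product sigma-algebra).        *)

Definition profile (dI : nat) := {ffun 'I_dI -> bool}.

Definition setp (dI : nat) (y : profile dI) (i : 'I_dI) (b : bool) : profile dI :=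
  [ffun j => if j == i then b else y j].

Definition same_minus (dI : nat) (i : 'I_dI) (y y' : profile dI) : Prop :=
  forall j, j != i -> y j = y' j.

(* Rationalizability: iterated (simultaneous) elimination of strictly       *)
(* dominated strategies in a finite game with payoffs u i y.                *)

Fixpoint surv (R : realType) (dI : nat) (u : 'I_dI -> profile dI -> R)
    (k : nat) (i : 'I_dI) (a : bool) : bool :=
  if k is k'.+1 then
    surv u k' i a &&
    ~~ [exists b : bool, surv u k' i b &&
         [forall y : profile dI,
            ((y i == a) && [forall j : 'I_dI, (j != i) ==> surv u k' j (y j)])
            ==> (u i y < u i (setp y i b))]]
  else true.

Definition rationalizable (R : realType) (dI : nat)
    (u : 'I_dI -> profile dI -> R) (y : profile dI) : Prop :=
  forall k i, surv u k i (y i).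

(* Parameters theta = (alpha, beta, Sigma).  alpha i y w stands for          *)
(* alpha_{i, y_{-i}}(w): the Theta-membership predicate requires it to       *)
(* depend on y only through y_{-i}.                                         *)

Record param (R : realType) (dI dW : nat) := Param {
  alpha : 'I_dI -> profile dI -> dW.-tuple R -> R;
  beta  : 'I_dI -> dW.-tuple R -> R;
  Sigma : dW.-tuple R -> 'M[R]_dI }.

Definition in_Theta (R : realType) (dI dW : nat) (th : param R dI dW) : Prop :=
  [/\ (forall i y, measurable_fun setT (alpha th i y)),
      (forall i y y', same_minus i y y' -> alpha th i y = alpha th i y'),
      (forall i, measurable_fun setT (beta th i)) &
      (forall i j, measurable_fun setT (fun w => Sigma th w i j))].

Definition payoff (R : realType) (dI dW : nat) (th : param R dI dW)
    (x : dI.-tuple R * dW.-tuple R) (e : dI.-tuple R)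
    (i : 'I_dI) (y : profile dI) : R :=
  (y i)%:R * (alpha th i y x.2 + beta th i x.2 * tnth x.1 i - tnth e i).

Definition dplay (R : realType) (dI dW : nat) :=
  profile dI -> dI.-tuple R * dW.-tuple R -> dI.-tuple R -> R.

Definition in_H (R : realType) (dI dW : nat) (h : dplay R dI dW) : Prop :=
  [/\ (forall y, measurable_fun setT (fun xe => h y xe.1 xe.2)),
      (forall y x e, 0 <= h y x e <= 1) &
      (forall x e, \sum_(y : profile dI) h y x e = 1)].

Definition S_R (R : realType) (dI dW : nat) (th : param R dI dW)
    (h : dplay R dI dW) : Prop :=
  forall x e y, 0 < h y x e -> rationalizable (payoff th x e) y.

(* Multivariate normal law N(0, Sigma) on R^dI: every nontrivial linear      *)
(* combination a'e is univariate normal with mean 0 and variance a'Sigma a.  *)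

Definition lincomb (R : realType) (dI : nat) (a e : dI.-tuple R) : R :=
  \sum_(i < dI) tnth a i * tnth e i.

Definition quadform (R : realType) (dI : nat) (M : 'M[R]_dI) (a : dI.-tuple R) : R :=
  \sum_(i < dI) \sum_(j < dI) tnth a i * M i j * tnth a j.

Definition is_normal0 (R : realType) (dI : nat)
    (P : probability (dI.-tuple R) R) (M : 'M[R]_dI) : Prop :=
  forall a : dI.-tuple R, (exists i, tnth a i != 0) ->
  forall B : set R, measurable B ->
    P (lincomb a @^-1` B) = normal_prob 0 (Num.sqrt (quadform M a)) B.

Definition sym_posdef (R : realType) (dI : nat) (M : 'M[R]_dI) : Prop :=
  M^T = M /\
  forall a : dI.-tuple R, (exists i, tnth a i != 0) -> 0 < quadform M a.

(* The fixed distribution of x = (z, w): w ~ muW, and z | w = w ~ Kz w.      *)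
(* W is the support of muW.                                                  *)

Definition box (R : realType) (k : nat) (c : k.-tuple R) (r : R) : set (k.-tuple R) :=
  [set v | forall i, `|tnth v i - tnth c i| < r].

Definition support (R : realType) (k : nat)
    (mu : set (k.-tuple R) -> \bar R) : set (k.-tuple R) :=
  [set c | forall r : R, 0 < r -> (0 < mu (box c r))%E].

Definition ae_x (R : realType) (dI dW : nat)
    (muW : probability (dW.-tuple R) R) (Kz : R.-pker (dW.-tuple R) ~> (dI.-tuple R))
    (Q : dI.-tuple R * dW.-tuple R -> Prop) : Prop :=
  {ae muW, forall w, {ae Kz w, forall z, Q (z, w)}}.

(* "Q(x, e) a.s." where e | x ~ N(0, Sigma(w)) under theta; G Sigma is the   *)
(* normal law N(0, Sigma).                                                   *)
Definition ae_xe (R : realType) (dI dW : nat)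
    (muW : probability (dW.-tuple R) R) (Kz : R.-pker (dW.-tuple R) ~> (dI.-tuple R))
    (G : 'M[R]_dI -> probability (dI.-tuple R) R) (th : param R dI dW)
    (Q : dI.-tuple R * dW.-tuple R -> dI.-tuple R -> Prop) : Prop :=
  ae_x muW Kz (fun x => {ae G (Sigma th x.2), forall e, Q x e}).

Definition condE (R : realType) (dI dW : nat)
    (G : 'M[R]_dI -> probability (dI.-tuple R) R) (th : param R dI dW)
    (h : dplay R dI dW) (x : dI.-tuple R * dW.-tuple R) (y : profile dI) : \bar R :=
  (\int[G (Sigma th x.2)]_e (h y x e)%:E)%E.

Definition Psi_R (R : realType) (dI dW : nat)
    (muW : probability (dW.-tuple R) R) (Kz : R.-pker (dW.-tuple R) ~> (dI.-tuple R))
    (G : 'M[R]_dI -> probability (dI.-tuple R) R)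
    (th : param R dI dW) (h : dplay R dI dW) : Prop :=
  let W := support muW in
  in_Theta th /\ in_H h /\
  [/\
      ((forall w, W w -> support (Kz w) = setT) /\
       (forall i w, W w -> beta th i w != 0)),
      (forall w, W w -> sym_posdef (Sigma th w) /\ forall i, Sigma th w i i = 1),
      (exists ht : profile dI -> dW.-tuple R -> dI.-tuple R -> R,
         (forall y, measurable_fun setT (fun wv => ht y wv.1 wv.2)) /\
         ae_xe muW Kz G th (fun x e => forall y,
            h y x e = ht y x.2 [tuple beta th i x.2 * tnth x.1 i - tnth e i | i < dI]))
    & (* A4 *) S_R th h].

(* Identification of (theta, h) with (theta', h'): parameters equal for       *)
(* muW-a.e. w, and h = h' almost surely (the paper's convention "h = h'").   *)
Definition equiv_pair (R : realType) (dI dW : nat)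
    (muW : probability (dW.-tuple R) R) (Kz : R.-pker (dW.-tuple R) ~> (dI.-tuple R))
    (G : 'M[R]_dI -> probability (dI.-tuple R) R)
    (th : param R dI dW) (h : dplay R dI dW)
    (th' : param R dI dW) (h' : dplay R dI dW) : Prop :=
  {ae muW, forall w, (forall i y, alpha th i y w = alpha th' i y w) /\
                     (forall i, beta th i w = beta th' i w) /\
                     Sigma th w = Sigma th' w} /\
  ae_xe muW Kz G th (fun x e => forall y, h y x e = h' y x e).

Definition discernible (R : realType) (dI dW : nat)
    (muW : probability (dW.-tuple R) R) (Kz : R.-pker (dW.-tuple R) ~> (dI.-tuple R))
    (G : 'M[R]_dI -> probability (dI.-tuple R) R)
    (S : param R dI dW -> dplay R dI dW -> Prop)
    (Psi : param R dI dW -> dplay R dI dW -> Prop) : Prop :=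
  ~ exists th h th' h',
      [/\ Psi th h, Psi th' h', S th h, ~ S th' h' &
          ae_x muW Kz (fun x => forall y, condE G th h x y = condE G th' h' x y)].

(* Main.v *)
(* Fix [w] in the support of its law; outcome probabilities agree on a dense set of [z].
   A strictly dominant action is played, a strictly dominated one is not, so the choice
   probability of player [i] lies between normal probabilities of [e_i < beta_i z_i - C]
   and [e_i <= beta_i z_i + C]; letting [z_i] vary identifies [beta_i].  When the opponents'
   [z_j] are sent to infinity in the direction that makes a given profile dominant, player
   [i] has a threshold rule and [alpha_i] is identified.  The probability that both [i] and
   [j] play [1] is, in the lower tail, of order [exp (- t ^ 2 / (1 + Sigma_ij))], which
   identifies [Sigma].  Finally the outcome probabilities are the convolution of
   [ht (., w)] with a nondegenerate normal law, and normal location families are complete,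
   so [h] is identified almost surely.

   The law [N(0, Sigma)] is only given through its one-dimensional projections.  All that is
   used of it follows from its Laplace transform: a signed measure with exponential moments
   whose Laplace transform vanishes is zero, which yields the Cameron-Martin formula, and
   through it both the tail estimates and completeness. *)
Require Import Defs.
From HB Require Import structures.
From mathcomp Require Import all_boot all_order all_algebra.
From mathcomp Require Import all_classical all_reals all_analysis.
From mathcomp Require Import measurable_realfun ring lra.
Set Implicit Arguments. Unset Strict Implicit. Unset Printing Implicit Defensive.
Import Order.TTheory GRing.Theory Num.Theory.
Import numFieldNormedType.Exports.
Local Open Scope classical_set_scope.
Local Open Scope ring_scope.

(** * Exponential growth *)

Section ExponentialGrowth.
Context (R : realType) (n : nat).
Local Notation E := (n.-tuple R).
Implicit Types (x s t : E) (f g : E -> R).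

Definition norm1 x : R := \sum_(i < n) `|tnth x i|.

Definition addt x t : E := [tuple tnth x i + tnth t i | i < n].
Definition scalet (c : R) x : E := [tuple c * tnth x i | i < n].
Definition axis (i : 'I_n) (c : R) : E := [tuple (j == i)%:R * c | j < n].

Lemma norm1_ge0 x : 0 <= norm1 x.
Proof. exact: sumr_ge0. Qed.

Lemma lincombDl s t x : lincomb (addt s t) x = lincomb s x + lincomb t x.
Proof.
by rewrite -big_split; apply: eq_bigr => i _; rewrite tnth_mktuple mulrDl.
Qed.

Lemma lincombDr s x t : lincomb s (addt x t) = lincomb s x + lincomb s t.
Proof.
by rewrite -big_split; apply: eq_bigr => i _; rewrite tnth_mktuple mulrDr.
Qed.

Lemma lincombZl c s x : lincomb (scalet c s) x = c * lincomb s x.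
Proof.
by rewrite mulr_sumr; apply: eq_bigr => i _; rewrite tnth_mktuple mulrA.
Qed.

Lemma lincomb_axis i c x : lincomb (axis i c) x = c * tnth x i.
Proof.
rewrite /lincomb (bigD1 i)//= tnth_mktuple eqxx mul1r big1 ?addr0// => j ji.
by rewrite tnth_mktuple (negbTE ji) !mul0r.
Qed.

Lemma norm1_coord x i : `|tnth x i| <= norm1 x.
Proof. by rewrite /norm1 (bigD1 i)//= lerDl sumr_ge0. Qed.

Lemma norm_lincomb s x : `|lincomb s x| <= norm1 s * norm1 x.
Proof.
apply: le_trans (ler_norm_sum _ _ _) _; rewrite mulr_suml ler_sum// => i _.
by rewrite normrM ler_wpM2l// norm1_coord.
Qed.

Lemma measurable_lincomb s : measurable_fun setT (lincomb s).
Proof.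
apply: measurable_sum => i; apply: measurable_funM => //.
exact: measurable_tnth.
Qed.

Lemma measurable_norm1 : measurable_fun setT norm1.
Proof.
apply: measurable_sum => i; apply: measurableT_comp => //.
exact: measurable_tnth.
Qed.

(** The growth class suited to normal laws: they integrate every [exp (K * norm1 x)], and the class
    is stable under sums and products and contains the exponentials of linear forms. *)
Definition dominated (C K : R) f := forall x, `|f x| <= C * expR (K * norm1 x).

Definition exp_growth f := exists C K, dominated C K f.

Lemma dominated_ge0 C K f x : dominated C K f -> 0 <= C * expR (K * norm1 x).
Proof. by move=> /(_ x); apply: le_trans. Qed.

Lemma dominatedW C K C' K' f : dominated C K f -> C <= C' -> K <= K' ->
  dominated C' K' f.
Proof.
move=> fCK CC' KK' x; apply: le_trans (fCK x) _.
have := dominated_ge0 x fCK; rewrite pmulr_lge0 ?expR_gt0// => C0.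
by rewrite ler_pM ?expR_ge0// ler_expR ler_wpM2r// norm1_ge0.
Qed.

Lemma dominatedM C K C' K' f g : dominated C K f -> dominated C' K' g ->
  dominated (C * C') (K + K') (fun x => f x * g x).
Proof.
move=> fCK gCK x; rewrite normrM mulrDl expRD.
rewrite (_ : C * C' * _ = (C * expR (K * norm1 x)) * (C' * expR (K' * norm1 x))); last by ring.
by rewrite ler_pM.
Qed.

Lemma dominatedD C K C' K' f g : dominated C K f -> dominated C' K' g ->
  dominated (C + C') (Num.max K K') (fun x => f x + g x).
Proof.
move=> fCK gCK x; apply: le_trans (ler_normD _ _) _; rewrite mulrDl lerD//.
  by apply: (dominatedW fCK) => //; rewrite le_max lexx.
by apply: (dominatedW gCK) => //; rewrite le_max lexx orbT.
Qed.

Lemma dominated_cst c : dominated `|c| 0 (fun=> c).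
Proof. by move=> x; rewrite mul0r expR0 mulr1. Qed.

Lemma dominated_bounded C f : (forall x, `|f x| <= C) -> dominated C 0 f.
Proof. by move=> fC x; rewrite mul0r expR0 mulr1. Qed.

Lemma dominated_exp s : dominated 1 (norm1 s) (fun x => expR (lincomb s x)).
Proof.
move=> x; rewrite mul1r ger0_norm ?expR_ge0// ler_expR.
by apply: le_trans (norm_lincomb s x); exact: ler_norm.
Qed.

End ExponentialGrowth.

(** * Integration against weighted image measures *)

Section WeightedIntegral.
Context (R : realType) (n : nat) d (T : measurableType d).
Variables (P : {measure set T -> \bar R}) (X : T -> n.-tuple R) (g : T -> R).
Hypotheses (mX : measurable_fun setT X) (mg : measurable_fun setT g).
Hypothesis intXg : forall K : R,
  P.-integrable setT (fun o => (expR (K * norm1 (X o)) * g o)%:E).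

Implicit Types (f : n.-tuple R -> R).

(** Integration against a signed measure on tuples: the image under [X] of [P] weighted by [g]. *)
Definition wint (f : n.-tuple R -> R) : R := \int[P]_o (f (X o) * g o).

Lemma measurable_wint f : measurable_fun setT f ->
  measurable_fun setT (fun o => f (X o) * g o).
Proof. by move=> mf; apply: measurable_funM => //; exact: measurableT_comp. Qed.

Lemma wint_integrable f : measurable_fun setT f -> exp_growth f ->
  P.-integrable setT (EFin \o (fun o => f (X o) * g o)).
Proof.
move=> mf [C [K fCK]].
apply: (le_integrable measurableT _ _ (integrableZl measurableT C (intXg K))).
  by apply/measurable_EFinP; exact: measurable_wint.
move=> o _ /=. rewrite lee_fin mulrA !normrM.
rewrite ler_wpM2r// -normrM (le_trans (fCK _))// ler_norm//.
Qed.

Lemma wintD f1 f2 : measurable_fun setT f1 -> measurable_fun setT f2 ->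
  exp_growth f1 -> exp_growth f2 ->
  wint (fun x => f1 x + f2 x) = wint f1 + wint f2.
Proof.
move=> mf1 mf2 gf1 gf2; rewrite /wint -RintegralD//; try exact: wint_integrable.
by apply: eq_Rintegral => o _; rewrite mulrDl.
Qed.

Lemma wint_cvg (f_ : nat -> n.-tuple R -> R) f C K :
  (forall m, measurable_fun setT (f_ m)) -> (forall m, dominated C K (f_ m)) ->
  (forall x, f_ ^~ x @ \oo --> f x) ->
  wint (f_ m) @[m --> \oo] --> wint f.
Proof.
move=> mf_ domf_ f_f.
have mf : measurable_fun setT f by apply: measurable_fun_cvg => // x _; exact: f_f.
have [|||||+ _ +] := @dominated_convergence _ _ _ P setT measurableT
  (fun m o => (f_ m (X o) * g o)%:E) (fun o => (f (X o) * g o)%:E)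
  (fun o => `|C%:E * (expR (K * norm1 (X o)) * g o)%:E|%E).
- by move=> m; apply/measurable_EFinP; exact: measurable_wint.
- by apply/measurable_EFinP; exact: measurable_wint.
- apply: aeW => o _; apply: cvg_EFin; first by near=> k.
  by apply: cvgMl; exact: f_f.
- exact/integrable_abse/integrableZl.
- apply: aeW => o m _; rewrite -EFinM lee_fin mulrA !normrM ler_wpM2r// -normrM.
  exact: le_trans (domf_ m _) (ler_norm _).
move=> intf; rewrite /wint /Rintegral => cv.
apply: (@fine_cvg _ _ _ _ (fun m => \int[P]_o (f_ m (X o) * g o)%:E)%E).
rewrite fineK//; exact: integrable_fin_num.
Unshelve. all: by end_near. Qed.

End WeightedIntegral.

(** * Elementary bounds and limits on the real line *)

Section RealLimits.
Context (R : realType).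
Implicit Types (u v r : R).

Lemma expR_sub1_ub v : expR v - 1 <= v * expR v.
Proof.
have := expR_ge1Dx (- v); rewrite expRN => h.
have : (1 - v) * expR v <= 1.
  by rewrite -ler_pdivlMr ?expR_gt0// div1r.
by lra.
Qed.

Lemma norm_expR_sub1 v : `|expR v - 1| <= `|v| * expR `|v|.
Proof.
have v1 := expR_sub1_ub v; have v2 := expR_ge1Dx v.
have a1 : `|v| <= `|v| * expR `|v| by rewrite ler_peMr// -[leLHS]expR0 ler_expR.
have a2 : `|v| * expR v <= `|v| * expR `|v| by rewrite ler_wpM2l// ler_expR ler_norm.
have a3 : v * expR v <= `|v| * expR v by rewrite ler_wpM2r ?expR_ge0// ler_norm.
have a4 := ler_norm (- v); rewrite normrN in a4.
by rewrite ler_norml; apply/andP; split; lra.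
Qed.

(** With [v = u / (m + 1)], a squeeze based on [v <= exp v - 1 <= v * exp v]. *)
Lemma cvg_expR_quotient u :
  m.+1%:R * (expR (u / m.+1%:R) - 1) @[m --> \oo] --> u.
Proof.
have inv0 : (m.+1%:R : R)^-1 @[m --> \oo] --> 0 by exact: cvg_harmonic.
have ucv : u / m.+1%:R @[m --> \oo] --> (0 : R).
  by rewrite -(mulr0 u); apply: cvgM => //; exact: cvg_cst.
apply: (@squeeze_cvgr _ _ _ _ (fun=> u) (fun m => u * expR (u / m.+1%:R))).
- apply: nearW => m; have m0 : (0 : R) < m.+1%:R by [].
  have h1 := expR_ge1Dx (u / m.+1%:R); have h2 := expR_sub1_ub (u / m.+1%:R).
  have e : u = m.+1%:R * (u / m.+1%:R) by rewrite mulrC divfK// gt_eqF.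
  set v := u / m.+1%:R in h1 h2 e *.
  by rewrite e -mulrA !ler_pM2l//; apply/andP; split; lra.
- exact: cvg_cst.
- have eu : u * expR 0 = u by rewrite expR0 mulr1.
  rewrite -[X in _ --> X]eu; apply: cvgM; first exact: cvg_cst.
  by apply: continuous_cvg ucv; exact: continuous_expR.
Qed.

(** Each term is bounded by that of the exponential series at [|u|]; since the bound is free of [m],
    it dominates all the partial sums at once. *)
Lemma series_sin_coeff_bound u m : `|series (sin_coeff u) m| <= expR `|u|.
Proof.
apply: le_trans (ler_norm_sum _ _ _) _.
have cvE := @is_cvg_series_exp_coeff R `|u|.
apply: (@le_trans _ _ (series (exp_coeff `|u|) m)).
  apply: ler_sum => k _; rewrite /sin_coeff /exp_coeff /=.
  rewrite !normrM normfV !normr_nat !normrX normrN normr1 expr1n mulr1.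
  by case: odd; [rewrite mul1r|rewrite !mul0r divr_ge0].
apply: nondecreasing_cvgn_le => //; apply/nondecreasing_seqP => k.
by rewrite /series /= big_nat_recr//= lerDl exp_coeff_ge0.
Qed.

(** [r ^ m] is at most each of the [m] terms of [1 + r + ... + r ^ (m - 1)], and [1 - r] times that
    sum is [1 - r ^ m]. *)
Lemma natmul_exp_le r m : 0 <= r -> r <= 1 -> m%:R * r ^+ m * (1 - r) <= 1 - r ^+ m.
Proof.
move=> r0 r1; elim: m => [|m IH]; first by rewrite mul0r mul0r expr0 subrr.
have e1 : 0 <= 1 - r ^+ m.+1 by rewrite subr_ge0 exprn_ile1.
have e2 : 0 <= r ^+ m by exact: exprn_ge0.
have := ler_wpM2l r0 IH; have := mulr_ge0 e1 (_ : 0 <= 1 - r); rewrite subr_ge0 => /(_ r1).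
by rewrite exprS -natr1; nra.
Qed.

Lemma cvg_natmul_exp r : 0 <= r -> r < 1 -> m%:R * r ^+ m @[m --> \oo] --> 0.
Proof.
(* By the arithmetic-geometric mean inequality [r <= s ^ 2], so [m * r ^ m] is at most
   [m * s ^ m * s ^ m], where [m * s ^ m] is bounded. *)
move=> r0 r1; pose s := (1 + r) / 2.
have s1 : s < 1 by rewrite /s; lra.
have s0 : 0 <= s by rewrite /s; lra.
have rs : r <= s ^+ 2 by rewrite /s; nra.
apply: (@squeeze_cvgr _ _ _ _ (fun=> 0) (fun m => (1 - s)^-1 * s ^+ m)).
- apply: nearW => m; rewrite mulr_ge0 ?exprn_ge0//=.
  have h : m%:R * s ^+ m <= (1 - s)^-1.
    rewrite -[leRHS]mul1r ler_pdivlMr ?subr_gt0//.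
    apply: le_trans (natmul_exp_le _ s0 (ltW s1)) _.
    by rewrite lerBlDr lerDl exprn_ge0.
  apply: le_trans (_ : m%:R * (s ^+ 2) ^+ m <= _).
    by rewrite ler_wpM2l// lerXn2r// nnegrE// sqr_ge0.
  by rewrite -exprM mulnC exprM expr2 mulrA ler_wpM2r// exprn_ge0.
- exact: cvg_cst.
- rewrite -(mulr0 (1 - s)^-1); apply: cvgM; first exact: cvg_cst.
  by apply: cvg_expr; rewrite ger0_norm.
Qed.

Lemma bernoulli_ge r m : 0 <= r -> r <= 1 -> 1 - m%:R * r <= (1 - r) ^+ m.
Proof.
move=> r0 r1; elim: m => [|m IH]; first by rewrite expr0 mul0r subr0.
have r1' : 0 <= 1 - r by lra.
have := ler_wpM2l r1' IH; rewrite exprS -natr1.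
have : 0 <= m%:R * r ^+ 2 by rewrite mulr_ge0// sqr_ge0.
by rewrite expr2; nra.
Qed.

(* The polynomials [(1 - s ^ m) ^ (m 2 ^ m)] of the Brosowski-Deutsch proof of
   Stone-Weierstrass; the extra factor [m] settles the tie [s = 1 / 2]. *)
Lemma cvg_step_poly r : 0 <= r <= 1 ->
  (1 - r ^+ m) ^+ (m * 2 ^ m) @[m --> \oo] --> ((r < 2^-1)%R%:R : R).
Proof.
move=> /andP[r0 r1].
have b1 m : 0 <= 1 - r ^+ m <= 1.
  by rewrite subr_ge0 exprn_ile1//= lerBlDr lerDl exprn_ge0.
(* Bernoulli settles [r < 1 / 2], since [m * 2 ^ m * r ^ m = m * (2 * r) ^ m] tends to 0. For
   [r >= 1 / 2] the power is at most [exp (- m * (2 * r) ^ m) <= exp (- m)]. *)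
have [rh|rh] := ltP r 2^-1.
  apply: (@squeeze_cvgr _ _ _ _ (fun m => 1 - m%:R * (2 * r) ^+ m) (fun=> 1)).
  - apply: nearW => m; apply/andP; split; last first.
      by have /andP[? ?] := b1 m; rewrite exprn_ile1.
    apply: le_trans (bernoulli_ge _ _ _); rewrite ?exprn_ge0 ?exprn_ile1//.
    by rewrite natrM natrX exprMn mulrA.
  - rewrite -[X in _ --> X]subr0; apply: cvgB; first exact: cvg_cst.
    by apply: cvg_natmul_exp; lra.
  - exact: cvg_cst.
apply: (@squeeze_cvgr _ _ _ _ (fun=> 0) (fun m => m.+1%:R^-1)).
- apply: nearW => m; have /andP[b10 b11] := b1 m; rewrite exprn_ge0//=.
  have em : 1 - r ^+ m <= expR (- r ^+ m) by exact: expR_ge1Dx.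
  have : (1 - r ^+ m) ^+ (m * 2 ^ m) <= expR (- r ^+ m) ^+ (m * 2 ^ m).
    by rewrite lerXn2r// nnegrE expR_ge0.
  move/le_trans; apply; rewrite -expRM_natl.
  apply: (@le_trans _ _ (expR (- m%:R))).
    rewrite ler_expR mulrN lerN2 natrM natrX -mulrA ler_peMr//.
    by rewrite -exprMn exprn_ege1//; lra.
  rewrite expRN lef_pV2 ?posrE ?expR_gt0//.
  by apply: le_trans (expR_ge1Dx _); rewrite -natr1 addrC.
- exact: cvg_cst.
- exact: cvg_harmonic.
Qed.

End RealLimits.

(** * Uniqueness of Laplace transforms *)

(* The multipliers form an algebra closed under dominated pointwise limits.  It contains
   exponentials, hence linear forms (difference quotients), sines (power series),
   indicators of half-spaces and, finally, all bounded measurable functions. *)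
Section Multipliers.
Context (R : realType) (n : nat) d (T : measurableType d).
Local Notation E := (n.-tuple R).
Variables (P : {measure set T -> \bar R}) (X1 X2 : T -> E) (g1 g2 : T -> R).
Hypotheses (mX1 : measurable_fun setT X1) (mX2 : measurable_fun setT X2).
Hypotheses (mg1 : measurable_fun setT g1) (mg2 : measurable_fun setT g2).
Hypothesis int1 : forall K : R,
  P.-integrable setT (fun o => (expR (K * norm1 (X1 o)) * g1 o)%:E).
Hypothesis int2 : forall K : R,
  P.-integrable setT (fun o => (expR (K * norm1 (X2 o)) * g2 o)%:E).
Implicit Types (f q : E -> R).

Let J1 := wint P X1 g1.
Let J2 := wint P X2 g2.

(** Weighting the two signed measures by [f] gives them the same Laplace transform. *)
Definition balanced f := [/\ measurable_fun setT f, exp_growth f &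
  forall t, J1 (fun x => f x * expR (lincomb t x)) =
            J2 (fun x => f x * expR (lincomb t x))].

(** Quantifying over all balanced [f] is what makes this class closed under products. *)
Definition multiplier q := [/\ measurable_fun setT q, exp_growth q &
  forall f, balanced f -> balanced (fun x => f x * q x)].

Lemma exp_growthM f q : exp_growth f -> exp_growth q ->
  exp_growth (fun x => f x * q x).
Proof.
move=> [C [K fCK]] [C' [K' qCK]]; exists (C * C'), (K + K').
exact: dominatedM.
Qed.

Lemma exp_growthD f q : exp_growth f -> exp_growth q ->
  exp_growth (fun x => f x + q x).
Proof.
move=> [C [K fCK]] [C' [K' qCK]]; exists (C + C'), (Num.max K K').
exact: dominatedD.
Qed.

Lemma exp_growth_exp t : exp_growth (fun x : E => expR (lincomb t x)).
Proof. by exists 1, (norm1 t); exact: dominated_exp. Qed.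

Lemma measurable_exp_lincomb t : measurable_fun setT (fun x : E => expR (lincomb t x)).
Proof. by apply: measurableT_comp => //; exact: measurable_lincomb. Qed.

Lemma balancedD f q : balanced f -> balanced q -> balanced (fun x => f x + q x).
Proof.
move=> [mf gf ef] [mq gq eq]; split.
- exact: measurable_funD.
- exact: exp_growthD.
- move=> t; under eq_fun do rewrite mulrDl.
  have mt := measurable_exp_lincomb t; have gt := exp_growth_exp t.
  rewrite /J1 /J2 !wintD//; first by congr (_ + _).
  all: by [apply: measurable_funM | apply: exp_growthM].
Qed.

(** Dominated convergence applies to both signed measures, because the functions
    [f * q_ m * exp (lincomb t)] share one exponential bound. *)
Lemma multiplier_dominated_lim (q_ : nat -> E -> R) q C K :
  (forall m, multiplier (q_ m)) -> (forall m, dominated C K (q_ m)) ->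
  (forall x, q_ ^~ x @ \oo --> q x) -> multiplier q.
Proof.
move=> Mq_ dq_ q_q.
have mq : measurable_fun setT q.
  by apply: (measurable_fun_cvg (h := q_)) => [m|x _]; [case: (Mq_ m)|exact: q_q].
have gq : exp_growth q.
  exists C, K => x.
  have : `|q_ m x| @[m --> \oo] --> `|q x| by apply: cvg_norm; exact: q_q.
  by move=> h; apply: (cvgr_to_le h); apply: nearW => m; exact: dq_.
split=> // f Bf; have [mf gf ef] := Bf; split; [exact: measurable_funM|exact: exp_growthM|].
move=> t; have [C' [K' fCK]] := gf.
pose f_ m x := f x * q_ m x * expR (lincomb t x).
have mf_ m : measurable_fun setT (f_ m).
  have [mqm _ _] := Mq_ m.
  apply: measurable_funM; last exact: measurable_exp_lincomb.
  exact: measurable_funM.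
have df_ m : dominated (C' * C * 1) (K' + K + norm1 t) (f_ m).
  by apply: dominatedM; [exact: dominatedM|exact: dominated_exp].
have cf_ x : f_ ^~ x @ \oo --> f x * q x * expR (lincomb t x).
  by apply: cvgMl; apply: cvgMr; exact: q_q.
have := wint_cvg mX1 mg1 int1 mf_ df_ cf_.
have := wint_cvg mX2 mg2 int2 mf_ df_ cf_.
have -> : (fun m => wint P X2 g2 (f_ m)) = (fun m => wint P X1 g1 (f_ m)).
  apply/funext => m; have [_ _ /(_ _ Bf) [_ _ /(_ t)]] := Mq_ m.
  exact: esym.
by move=> c2 c1; exact: cvg_unique c1 c2.
Qed.

Lemma multiplier_cst c : multiplier (fun=> c).
Proof.
have gc : exp_growth (fun=> c : R) by exists `|c|, 0; exact: dominated_cst.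
split=> // f [mf gf ef]; split; [exact: measurable_funM|exact: exp_growthM|].
move=> t; have gt := exp_growth_exp t; have mt := measurable_exp_lincomb t.
have h : (fun x => f x * c * expR (lincomb t x)) =
    (fun x => c * (f x * expR (lincomb t x))).
  by apply/funext => x; rewrite mulrAC mulrC.
rewrite h; have mft : measurable_fun setT (fun x => f x * expR (lincomb t x)).
  exact: measurable_funM.
have gft : exp_growth (fun x => f x * expR (lincomb t x)) by exact: exp_growthM.
have aux Y g : measurable_fun setT Y -> measurable_fun setT g ->
  (forall K : R, P.-integrable setT (fun o => (expR (K * norm1 (Y o)) * g o)%:E)) ->
  wint P Y g (fun x => c * (f x * expR (lincomb t x))) =
  c * wint P Y g (fun x => f x * expR (lincomb t x)).
  move=> mY mg iYg; rewrite /wint -RintegralZl//; last exact: (wint_integrable mY mg iYg mft gft).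
  by apply: eq_Rintegral => o _; rewrite -!mulrA.
by rewrite /J1 /J2 !aux//; congr (_ * _); exact: ef.
Qed.

Lemma multiplierM q q' : multiplier q -> multiplier q' ->
  multiplier (fun x => q x * q' x).
Proof.
move=> [mq gq Mq] [mq' gq' Mq']; split; [exact: measurable_funM|exact: exp_growthM|].
move=> f /Mq /Mq'; congr balanced; apply/funext => x; exact/esym/mulrA.
Qed.

Lemma multiplierD q q' : multiplier q -> multiplier q' ->
  multiplier (fun x => q x + q' x).
Proof.
move=> [mq gq Mq] [mq' gq' Mq']; split; [exact: measurable_funD|exact: exp_growthD|].
move=> f Bf; have := balancedD (Mq _ Bf) (Mq' _ Bf).
by congr balanced; apply/funext => x; exact/esym/mulrDr.
Qed.

Lemma multiplierB q q' : multiplier q -> multiplier q' ->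
  multiplier (fun x => q x - q' x).
Proof.
move=> Mq Mq'; have := multiplierD Mq (multiplierM (multiplier_cst (-1)) Mq').
by congr multiplier; apply/funext => x; rewrite mulN1r.
Qed.

Lemma multiplierX q m : multiplier q -> multiplier (fun x => q x ^+ m).
Proof.
move=> Mq; elim: m => [|m IH]; first exact: multiplier_cst.
have := multiplierM Mq IH.
by congr multiplier; apply/funext => x; rewrite exprS.
Qed.

Lemma multiplier_sum (I : Type) (s : seq I) (q_ : I -> E -> R) :
  (forall i, multiplier (q_ i)) -> multiplier (fun x => \sum_(i <- s) q_ i x).
Proof.
move=> Mq_; elim: s => [|i s IH].
  by under eq_fun do rewrite big_nil; exact: multiplier_cst.
by under eq_fun do rewrite big_cons; exact: multiplierD.
Qed.

(** Multiplication by this exponential only translates the argument of the Laplace transform by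
    [s]. *)
Lemma multiplier_exp s : multiplier (fun x => expR (lincomb s x)).
Proof.
split; [exact: measurable_exp_lincomb|exact: exp_growth_exp|].
move=> f [mf gf ef]; split.
- by apply: measurable_funM => //; exact: measurable_exp_lincomb.
- by apply: exp_growthM => //; exact: exp_growth_exp.
- move=> t; have := ef (addt s t).
  by congr (J1 _ = J2 _); apply/funext => x; rewrite lincombDl expRD mulrA.
Qed.

Lemma multiplier_lincomb s : multiplier (lincomb s).
Proof.
apply: (@multiplier_dominated_lim
  (fun m x => m.+1%:R * (expR (lincomb s x / m.+1%:R) - 1)) _ 1 (2 * norm1 s)).
- move=> m; apply: multiplierM; first exact: multiplier_cst.
  apply: multiplierB; last exact: multiplier_cst.
  have := multiplier_exp (scalet m.+1%:R^-1 s).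
  by congr multiplier; apply/funext => x; rewrite lincombZl mulrC.
(* The difference quotient is at most [|u| * exp |u| <= exp (2 * |u|)], whence the rate
   [2 * norm1 s]. *)
- move=> m x; set u := lincomb s x; rewrite mul1r.
  have m0 : (0 : R) < m.+1%:R by [].
  rewrite normrM normr_nat.
  apply: (@le_trans _ _ (m.+1%:R * (`|u / m.+1%:R| * expR `|u / m.+1%:R|))).
    by rewrite ler_wpM2l// norm_expR_sub1.
  rewrite mulrA normrM normfV normr_nat [m.+1%:R * _]mulrC divfK ?gt_eqF//.
  have um : `|u| / m.+1%:R <= `|u|.
    by rewrite ler_piMr// invf_le1// ler1n.
  apply: (@le_trans _ _ (expR `|u| * expR `|u|)).
    rewrite ler_pM ?ler_expR ?expR_ge0//.
    by apply: le_trans (expR_ge1Dx _); rewrite lerDr.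
  by rewrite -expRD ler_expR -mulrA mulr_natl mulr2n lerD// norm_lincomb.
- by move=> x; exact: cvg_expR_quotient.
Qed.

(** The sine turns an unbounded linear form into a function with values in [[-1, 1]], as
    [multiplier_lt] requires. *)
Lemma multiplier_sin s : multiplier (fun x => sin (lincomb s x)).
Proof.
apply: (@multiplier_dominated_lim
  (fun m x => series (sin_coeff (lincomb s x)) m) _ 1 (norm1 s)).
- move=> m; rewrite /series/=; apply: multiplier_sum => k; rewrite /sin_coeff/=.
  apply: multiplierM; last exact: multiplier_cst.
  apply: multiplierM; first exact: multiplier_cst.
  exact/multiplierX/multiplier_lincomb.
- move=> m x; rewrite mul1r; apply: le_trans (series_sin_coeff_bound _ _) _.
  by rewrite ler_expR norm_lincomb.
- move=> x; rewrite unlock; exact: is_cvg_series_sin_coeff.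
Qed.

Lemma multiplier_lt q c : multiplier q -> (forall x, `|q x| <= 1) -> `|c| <= 1 ->
  multiplier (fun x => (q x < c)%R%:R).
Proof.
(* As [q x - c] lies in [[-2, 2]], [r x] lies in [[0, 1]], and it is below [1 / 2] exactly where
   [q x] is below [c]. *)
move=> Mq q1 c1; pose r x := 2^-1 + (q x - c) / 4.
have r01 x : 0 <= r x <= 1.
  by have := q1 x; move: c1; rewrite /r !ler_norml => /andP[? ?] /andP[? ?]; lra.
apply: (@multiplier_dominated_lim
  (fun m x => (1 - r x ^+ m) ^+ (m * 2 ^ m)) _ 1 0).
- move=> m; apply/multiplierX/multiplierB; first exact: multiplier_cst.
  apply/multiplierX/multiplierD; first exact: multiplier_cst.
  apply: multiplierM; last exact: multiplier_cst.
  by apply: multiplierB => //; exact: multiplier_cst.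
- move=> m; apply: dominated_bounded => x; have /andP[r0 r1] := r01 x.
  rewrite ger0_norm; first rewrite exprn_ile1//.
  + by rewrite subr_ge0 exprn_ile1.
  + by rewrite lerBlDr lerDl exprn_ge0.
  + by rewrite exprn_ge0// subr_ge0 exprn_ile1.
- move=> x; have := cvg_step_poly (r01 x).
  have -> // : (r x < 2^-1) = (q x < c).
  by rewrite /r; apply/idP/idP; lra.
Qed.

(** For large [m] both [x_i / (m + 1)] and [a / (m + 1)] fall in [[- pi / 2, pi / 2]], where the
    sine is increasing; the approximating indicators are thus eventually constant at each point. *)
Lemma multiplier_coord_lt i a : multiplier (fun x => (tnth x i < a)%R%:R).
Proof.
apply: (@multiplier_dominated_lim
  (fun m x => (sin (tnth x i / m.+1%:R) < sin (a / m.+1%:R))%R%:R) _ 1 0).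
- move=> m; apply: multiplier_lt; [|by move=> x; exact: sin_max|exact: sin_max].
  have := multiplier_sin (axis i m.+1%:R^-1).
  by congr multiplier; apply/funext => x; rewrite lincomb_axis mulrC.
- by move=> m; apply: dominated_bounded => x; case: (_ < _); rewrite ?normr1 ?normr0.
- move=> x; apply: cvg_near_cst; near=> m.
  have m0 : (0 : R) < m.+1%:R by [].
  have small b : `|b| <= `|tnth x i| + `|a| -> b / m.+1%:R \in `[- (pi / 2), pi / 2].
    move=> bb; rewrite in_itv /= -ler_norml normrM normfV normr_nat ler_pdivrMr//.
    apply: (le_trans bb).
    have p2 : (1 : R) <= pi / 2 by have := @pi_ge2 R; lra.
    apply: (@le_trans _ _ m.+1%:R); last by rewrite ler_peMl.
    rewrite -natr1; apply: (@le_trans _ _ m%:R); last by rewrite lerDl.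
    by near: m; exact: nbhs_infty_ger.
  rewrite ltr_sin ?ltr_pM2r ?invr_gt0//.
    by apply: small; rewrite lerDl.
  by apply: small; rewrite lerDr.
Unshelve. all: by end_near. Qed.

Let mset (B : set E) := multiplier (\1_B).

Let mset_sigma : sigma_algebra setT mset.
Proof.
have msetC B : mset B -> mset (~` B).
  move=> MB; have := multiplierB (multiplier_cst 1) MB.
  congr multiplier; apply/funext => x; rewrite !indicE in_setC.
  by case: (x \in B); rewrite ?subrr ?subr0.
have msetI B B' : mset B -> mset B' -> mset (B `&` B').
  move=> MB MB'; have := multiplierM MB MB'.
  by congr multiplier; apply/funext => x; rewrite indicI.
have mset0 : mset set0 by have := multiplier_cst 0; rewrite /mset indic0.
split=> //.
- by move=> A MA; rewrite setTD; exact: msetC.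
- move=> A MA.
  have MU m : mset (\big[setU/set0]_(k < m) A k).
    elim: m => [|m IH]; first by rewrite big_ord0.
    rewrite big_ord_recr/= -[X in mset X]setCK setCU.
    by apply: (msetC); apply: msetI; exact: msetC.
  apply: (@multiplier_dominated_lim _ _ 1 0 MU).
  + move=> m; apply: dominated_bounded => x.
    by rewrite indicE; case: (_ \in _); rewrite ?normr1 ?normr0.
  + move=> x; apply: cvg_near_cst; have [[k _ Akx]|nA] := pselect ((\bigcup_k A k) x).
      near=> m; rewrite !indicE !mem_set//; first by exists k.
      rewrite -bigcup_mkord; exists k => //=.
      by near: m; exact: nbhs_infty_gt.
    apply: nearW => m; rewrite !indicE !memNset//; rewrite -bigcup_mkord.
    by move=> [k _ Akx]; apply: nA; exists k.
Unshelve. all: by end_near. Qed.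

(** The sets whose indicator is a multiplier form a sigma-algebra, so generators suffice: preimages
    of rays under a coordinate. *)
Lemma multiplier_indic (B : set E) : measurable B -> multiplier (\1_B).
Proof.
move: B; apply: smallest_sub; first exact: mset_sigma.
rewrite -bigcup_seq => _ [i _ [U mU <-]]; rewrite setTI.
have [s0 sC sU] := mset_sigma.
suff : measurable `<=` (fun U : set R => mset ((fun x : E => tnth x i) @^-1` U)).
  exact.
rewrite [X in X `<=` _](RGenInftyO.measurableE R); apply: smallest_sub.
  split.
  - by rewrite preimage_set0.
  - by move=> A MA; rewrite setTD preimage_setC -setTD; exact: sC.
  - by move=> A MA; rewrite preimage_bigcup; exact: sU.
move=> _ [a ->]; have := multiplier_coord_lt i a.
congr multiplier; apply/funext => x; rewrite indicE; congr ((nat_of_bool _)%:R).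
by apply/idP/idP => [xa|]; [rewrite inE /= in_itv|rewrite inE /= in_itv].
Qed.

Import HBNNSimple.

(** Adding the constant [C] makes [q] nonnegative; it is then an increasing limit of simple
    functions, all below [C]. *)
Lemma multiplier_bounded q (C : R) : measurable_fun setT q -> (forall x, `|q x| <= C) ->
  multiplier q.
Proof.
wlog q0 : q C / forall x, 0 <= q x.
  move=> H mq qC; have /H : forall x, 0 <= q x + C.
    by move=> x; have := qC x; rewrite ler_norml; lra.
  move=> /(_ (C + C)); case=> [||mq' gq' Mq'].
  - by apply: measurable_funD.
  - by move=> x; have := qC x; rewrite !ler_norml => /andP[? ?]; apply/andP; split; lra.
  have := multiplierB (And3 mq' gq' Mq') (multiplier_cst C).
  by congr multiplier; apply/funext => x; rewrite addrK.
move=> mq qC.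
have mqE : measurable_fun setT (EFin \o q) by exact/measurable_EFinP.
have q0E x : setT x -> (0 <= (EFin \o q) x)%E by move=> _; rewrite lee_fin.
pose q_ := nnsfun_approx measurableT mqE.
have q_q x : q_ ^~ x @ \oo --> q x.
  by have /fine_cvg := cvg_nnsfun_approx measurableT mqE q0E (x := x) I.
apply: (@multiplier_dominated_lim (fun m x => q_ m x) _ C 0) => //.
- move=> m; under eq_fun do rewrite fimfunEord.
  apply: multiplier_sum => k; apply: multiplierM; first exact: multiplier_cst.
  exact: multiplier_indic.
- move=> m; apply: dominated_bounded => x; rewrite ger0_norm; last exact: fun_ge0.
  apply: (le_trans _ (le_trans (ler_norm _) (qC x))).
  have nd : nondecreasing_seq (q_ ^~ x).
    by move=> a b ab; apply/lefP/nd_nnsfun_approx.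
  rewrite -[leRHS](cvg_lim _ (q_q x))//; apply: nondecreasing_cvgn_le => //.
  by apply/cvg_ex; exists (q x).
Qed.

(** The hypothesis says that the constant 1 is balanced; it is multiplied by [q], and the transforms
    are evaluated at 0. *)
Theorem laplace_uniqueness q C :
  (forall t, J1 (fun x => expR (lincomb t x)) = J2 (fun x => expR (lincomb t x))) ->
  measurable_fun setT q -> (forall x, `|q x| <= C) -> J1 q = J2 q.
Proof.
move=> J12 mq qC.
have B1 : balanced (fun=> 1).
  split=> //; first by exists `|1|, 0; exact: dominated_cst.
  by move=> t; have := J12 t; congr (J1 _ = J2 _); apply/funext => x; rewrite mul1r.
have [_ _ /(_ _ B1) [_ _ /(_ [tuple 0 | i < n])]] := multiplier_bounded mq qC.
congr (J1 _ = J2 _); apply/funext => x; rewrite mul1r /lincomb big1 ?expR0 ?mulr1//.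
all: by move=> i _; rewrite tnth_mktuple mul0r.
Qed.

End Multipliers.

(** * Normal laws *)

Section NormalProb.
Context (R : realType).
Implicit Types (s : R) (f : R -> \bar R).
Local Notation mu := (@lebesgue_measure R).

(** The Radon-Nikodym derivative of [normal_prob] agrees almost everywhere with its explicit
    density. *)
Lemma integral_normal_prob m s f : (forall x, 0 <= f x)%E ->
  measurable_fun setT f ->
  (\int[normal_prob m s]_x f x = \int[mu]_x (f x * (normal_pdf m s x)%:E))%E.
Proof.
move=> f0 mf; have dom := normal_prob_dominates m s.
rewrite -(Radon_Nikodym_SigmaFinite.change_of_variables dom)//.
have irn := Radon_Nikodym_SigmaFinite.f_integrable dom.
apply: ae_eq_integral => //.
- by apply: emeasurable_funM => //; exact: measurable_int irn.
- by apply: emeasurable_funM => //; apply/measurable_EFinP; exact: measurable_normal_pdf.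
- apply: ae_eqe_mul2l => /=; apply: integral_ae_eq => //=.
  + by apply/measurable_EFinP; exact: measurable_normal_pdf.
  + by move=> A _ mA; rewrite -Radon_Nikodym_SigmaFinite.f_integral.
Qed.

(** Completing the square: [exp x] times the density centred at 0 is [exp (s ^ 2 / 2)] times the
    density centred at [s ^ 2]. *)
Lemma normal_mgf s : s != 0 ->
  (\int[normal_prob 0 s]_x (expR x)%:E = (expR (s ^+ 2 / 2))%:E)%E.
Proof.
move=> s0; rewrite integral_normal_prob//; last first.
  by apply/measurable_EFinP; exact: measurable_expR.
have ss0 : s ^+ 2 != 0 by rewrite sqrf_eq0.
under eq_integral => x _.
  have -> : ((expR x)%:E * (normal_pdf 0 s x)%:E =
    (expR (s ^+ 2 / 2))%:E * (normal_pdf (s ^+ 2) s x)%:E)%E.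
    rewrite -!EFinM !normal_pdfE// /normal_fun mulrCA -expRD.
    rewrite [in RHS]mulrCA -expRD; congr (_ * expR _)%:E.
    rewrite -[s ^+ 2 *+ 2]mulr_natr; field.
    by rewrite ?ss0 ?s0.
  over.
rewrite /= ge0_integralZl//=.
- by rewrite integral_normal_pdf mule1.
- by apply/measurable_EFinP; exact: measurable_normal_pdf.
- by move=> x _; rewrite lee_fin normal_pdf_ge0.
Qed.

Lemma normal_prob_itv_gt0 m s p q : s != 0 -> p < q ->
  (0 < normal_prob m s `]p, q[)%E.
Proof.
move=> s0 pq; rewrite /normal_prob.
(* [c] bounds the density from below on the interval, where the distance to [m] is at most
   [|p - m| + |q - m|]. *)
pose c := normal_peak s * expR (- (`|p - m| + `|q - m|) ^+ 2 / (s ^+ 2 *+ 2)).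
have c0 : 0 < c by rewrite mulr_gt0 ?expR_gt0// normal_peak_gt0.
apply: (@lt_le_trans _ _ (\int[mu]_(x in `]p, q[) c%:E)%E).
  rewrite integral_cst//= lebesgue_measure_itv/= lte_fin pq -EFinB.
  by rewrite -EFinM lte_fin mulr_gt0// subr_gt0.
apply: ge0_le_integral => //=.
- by move=> x _; rewrite lee_fin ltW.
- by apply/measurable_funTS/measurable_EFinP; exact: measurable_normal_pdf.
- move=> x; rewrite in_itv/= => /andP[px xq]; rewrite lee_fin normal_pdfE// /c.
  rewrite ler_pM2l ?normal_peak_gt0// ler_expR ler_wpM2r//.
    by rewrite invr_ge0 mulrn_wge0// sqr_ge0.
  rewrite lerN2 -[leLHS]real_normK ?num_real// lerXn2r ?nnegrE ?addr_ge0//.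
  have h1 := ler_norm (q - m); have h2 := ler_norm (- (p - m)).
  have h3 := normr_ge0 (q - m); have h4 := normr_ge0 (p - m).
  by rewrite normrN in h2; rewrite ler_norml; apply/andP; split; lra.
Qed.

End NormalProb.

Section NormalLaw.
Context (R : realType) (n : nat).
Local Notation E := (n.-tuple R).
Variables (P : probability E R) (M : 'M[R]_n).
Hypotheses (posM : sym_posdef M) (normP : is_normal0 P M).
Implicit Types (s t : E).

(** The displacement that Cameron-Martin attaches to the weight [exp (lincomb s)]. *)
Definition mulMt s : E := [tuple \sum_(j < n) M i j * tnth s j | i < n].

Lemma quadform_lincomb s : quadform M s = lincomb s (mulMt s).
Proof.
apply: eq_bigr => i _; rewrite tnth_mktuple mulr_sumr.
by apply: eq_bigr => j _; rewrite mulrA.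
Qed.

Lemma quadformD s t :
  quadform M (addt s t) = quadform M s + 2 * lincomb t (mulMt s) + quadform M t.
Proof.
have symM i j : M i j = M j i by have [/matrixP /(_ i j) <- _] := posM; rewrite mxE.
have -> : 2 * lincomb t (mulMt s) =
    \sum_(i < n) \sum_(j < n) (tnth t i * M i j * tnth s j) +
    \sum_(i < n) \sum_(j < n) (tnth s i * M i j * tnth t j).
  rewrite mulr_natl mulr2n; congr (_ + _).
    by apply: eq_bigr => i _; rewrite tnth_mktuple mulr_sumr; apply: eq_bigr => j _; rewrite mulrA.
  rewrite exchange_big/=; apply: eq_bigr => i _; rewrite tnth_mktuple mulr_sumr.
  by apply: eq_bigr => j _; rewrite symM; ring.
rewrite /quadform -!big_split; apply: eq_bigr => i _ /=; rewrite -!big_split.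
by apply: eq_bigr => j _ /=; rewrite !tnth_mktuple; ring.
Qed.

Lemma tuple_eq0P s : (exists i, tnth s i != 0) \/ (forall i, tnth s i = 0).
Proof.
have [[i si]|h] := pselect (exists i, tnth s i != 0); [by left; exists i|right=> i].
by apply: contrapT => /eqP si; apply: h; exists i.
Qed.

Lemma normal_law_mgf t :
  (\int[P]_e (expR (lincomb t e))%:E = (expR (quadform M t / 2))%:E)%E.
Proof.
(* [is_normal0] concerns nonzero directions, so [t = 0] is treated apart; otherwise the univariate
   formula applies to the law of [lincomb t]. *)
have [t0|t0] := tuple_eq0P t; last first.
  have -> : quadform M t = 0.
    by rewrite quadform_lincomb /lincomb big1// => i _; rewrite t0 mul0r.
  under eq_integral => e _.
    rewrite (_ : lincomb t e = 0); last by rewrite /lincomb big1// => i _; rewrite t0 mul0r.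
    over.
  by rewrite mul0r integral_cst//= probability_setT mule1.
have q0 : 0 < quadform M t by have [_ /(_ _ t0)] := posM.
have s0 : Num.sqrt (quadform M t) != 0 by rewrite gt_eqF// sqrtr_gt0.
have := normal_mgf s0; rewrite sqr_sqrtr ?ltW// => <-.
have ml : measurable_fun setT (lincomb t : E -> measurableTypeR R).
  by move=> mT B mB; exact: (measurable_lincomb t mT mB).
have mexp : measurable_fun [set: measurableTypeR R] (fun x => (expR x)%:E).
  by apply/measurable_EFinP; exact: measurable_expR.
have := @ge0_integral_pushforward _ _ _ _ _ _ ml P setT
  (fun x => (expR x)%:E) measurableT mexp.
rewrite preimage_setT => <-; last by move=> y _; rewrite lee_fin expR_ge0.
apply: eq_measure_integral => A mA _.
exact: normP.
Qed.

Lemma integrable_exp_lincomb t : P.-integrable setT (fun e => (expR (lincomb t e))%:E).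
Proof.
apply/integrableP; split.
  by apply/measurable_EFinP; exact: measurable_exp_lincomb.
under eq_integral => e _ do rewrite /= ger0_norm ?expR_ge0//.
by rewrite normal_law_mgf ltry.
Qed.

Lemma integrable_exp_norm1 (K : R) : P.-integrable setT (fun e => (expR (K * norm1 e))%:E).
Proof.
(* Induction over the coordinates bounds [exp (K * |e_i|)] by the sum of [exp (K * e_i)] and
   [exp (- K * e_i)]; the free linear form [t] collects these terms. *)
suff H (r : seq 'I_n) t : P.-integrable setT
    (fun e => (expR (lincomb t e + K * \sum_(i <- r) `|tnth e i|))%:E).
  have := H (index_enum _) [tuple 0 | i < n].
  congr (P.-integrable setT); apply/funext => e; congr (expR _)%:E.
  rewrite [lincomb _ _]big1 ?add0r// => i _.
  by rewrite tnth_mktuple mul0r.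
elim: r t => [|i r IH] t.
  have := integrable_exp_lincomb t; congr (P.-integrable setT).
  by apply/funext => e; rewrite big_nil mulr0 addr0.
have := integrableD measurableT (IH (addt t (axis i K))) (IH (addt t (axis i (- K)))).
apply: le_integrable => //.
- apply/measurable_EFinP; apply: measurableT_comp => //.
  apply: measurable_funD; first exact: measurable_lincomb.
  apply: measurable_funM => //; apply: measurable_sum => j.
  by apply: measurableT_comp => //; exact: measurable_tnth.
- move=> e _ /=; rewrite lee_fin !ger0_norm ?addr_ge0 ?expR_ge0//.
  rewrite big_cons !lincombDl !lincomb_axis.
  have [x0|x0] := leP 0 (tnth e i).
    rewrite (ger0_norm x0); set a := expR _; set b := expR _; set c := expR _.
    have -> : a = b by rewrite /a /b; congr expR; ring.
    by rewrite lerDl expR_ge0.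
  rewrite (ltr0_norm x0); set a := expR _; set b := expR _; set c := expR _.
  have -> : a = c by rewrite /a /c; congr expR; ring.
  by rewrite lerDr expR_ge0.
Qed.

(* Cameron-Martin: both sides have the same Laplace transform in [f]. *)
Theorem normal_law_shift s (f : E -> R) (C : R) : measurable_fun setT f -> (forall x, `|f x| <= C) ->
  \int[P]_e f (addt e (mulMt s)) =
  expR (- (quadform M s / 2)) * \int[P]_e (f e * expR (lincomb s e)).
Proof.
move=> mf fC.
pose c := expR (- (quadform M s / 2)).
(* The first measure is the law of [e + M s], the second is [P] reweighted by
   [c * exp (lincomb s e)]. *)
pose X1 (e : E) := addt e (mulMt s); pose g1 (e : E) : R := 1.
pose X2 (e : E) := e; pose g2 (e : E) := c * expR (lincomb s e).
have mX1 : measurable_fun setT X1.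
  apply/measurable_fun_tnthP => i.
  rewrite (_ : _ \o _ = (fun e => tnth e i + tnth (mulMt s) i)); last first.
    by apply/funext => e /=; rewrite tnth_mktuple.
  by apply: measurable_funD => //; exact: measurable_tnth.
have mX2 : measurable_fun setT X2 by exact: measurable_id.
have mg1 : measurable_fun setT g1 by exact: measurable_cst.
have mg2 : measurable_fun setT g2.
  by apply: measurable_funM => //; exact: measurable_exp_lincomb.
have int1 (K : R) : P.-integrable setT (fun e => (expR (K * norm1 (X1 e)) * g1 e)%:E).
  have : P.-integrable setT (fun e => ((expR (`|K| * norm1 (mulMt s)))%:E *
      (expR (`|K| * norm1 e))%:E)%E) by apply: integrableZl => //; exact: integrable_exp_norm1.
  move=> h; apply: (le_integrable measurableT _ _ h).
    apply/measurable_EFinP; apply: measurable_funM => //.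
    apply: measurableT_comp => //; apply: measurable_funM => //.
    by apply: measurableT_comp mX1; exact: measurable_norm1.
  move=> e _ /=; rewrite lee_fin /g1 mulr1 [leRHS]ger0_norm ?mulr_ge0 ?expR_ge0// ger0_norm ?expR_ge0//.
  rewrite -expRD ler_expR -mulrDr.
  apply: (@le_trans _ _ (`|K| * norm1 (X1 e))).
    by rewrite ler_wpM2r ?norm1_ge0// ler_norm.
  rewrite ler_wpM2l// /norm1 -big_split ler_sum// => i _ /=.
  by rewrite tnth_mktuple addrC ler_normD.
have int2 (K : R) : P.-integrable setT (fun e => (expR (K * norm1 (X2 e)) * g2 e)%:E).
  have : P.-integrable setT (fun e => (c%:E * (expR ((K + norm1 s) * norm1 e))%:E)%E).
    by apply: integrableZl => //; exact: integrable_exp_norm1.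
  move=> h; apply: (le_integrable measurableT _ _ h).
    apply/measurable_EFinP; apply: measurable_funM => //.
    apply: measurableT_comp => //; apply: measurable_funM => //.
    exact: measurable_norm1.
  move=> e _ /=; rewrite lee_fin !ger0_norm ?mulr_ge0 ?expR_ge0//.
  rewrite /g2 mulrCA ler_wpM2l ?expR_ge0// -expRD ler_expR mulrDl lerD2l.
  by apply: le_trans (norm_lincomb s e); exact: ler_norm.
have J12 t : wint P X1 g1 (fun x => expR (lincomb t x)) =
             wint P X2 g2 (fun x => expR (lincomb t x)).
  rewrite /wint.
  (* Both transforms equal this product: in the second, the cross term of [quadform M (addt s t)]
     gives [lincomb t (mulMt s)], and [c] cancels the contribution of [quadform M s]. *)
  transitivity (expR (lincomb t (mulMt s)) * expR (quadform M t / 2)).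
    rewrite -[X in _ * X](_ : fine (\int[P]_e (expR (lincomb t e))%:E)%E = _); last first.
      by rewrite normal_law_mgf.
    rewrite -RintegralZl//; last exact: integrable_exp_lincomb.
    by apply: eq_Rintegral => e _; rewrite /g1 mulr1 lincombDr expRD mulrC.
  have -> : expR (lincomb t (mulMt s)) * expR (quadform M t / 2) =
     c * expR (quadform M (addt s t) / 2).
    by rewrite -!expRD quadformD; congr expR; field.
  rewrite -[X in _ * X](_ : fine (\int[P]_e (expR (lincomb (addt s t) e))%:E)%E = _); last first.
    by rewrite normal_law_mgf.
  rewrite -RintegralZl//; last exact: integrable_exp_lincomb.
  by apply: eq_Rintegral => e _; rewrite /g2 lincombDl expRD; ring.
have := laplace_uniqueness mX1 mX2 mg1 mg2 int1 int2 J12 mf fC.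
rewrite /wint => h; rewrite -RintegralZl//.
  transitivity (\int[P]_o (f (X1 o) * g1 o)).
    by apply: eq_Rintegral => e _; rewrite /g1 mulr1.
  by rewrite h; apply: eq_Rintegral => e _; rewrite /X2 /g2 /c; ring.
apply: (le_integrable measurableT _ _ (integrableZl measurableT C (integrable_exp_lincomb s))).
  apply/measurable_EFinP; apply: measurable_funM => //; exact: measurable_exp_lincomb.
move=> e _ /=; rewrite lee_fin !normrM ler_wpM2r// (le_trans (fC e))// ler_norm//.
Qed.

End NormalLaw.

(** * Completeness *)

Section Completeness.
Context (R : realType) (n : nat).
Local Notation E := (n.-tuple R).
Implicit Types (s t u : E).

Definition subt t u : E := [tuple tnth t i - tnth u i | i < n].

(** A nonzero vector of the left kernel would give the quadratic form the value 0. *)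
Lemma sym_posdef_unit (M : 'M[R]_n) : sym_posdef M -> M \in unitmx.
Proof.
move=> [_ posM]; rewrite -row_free_unit -kermx_eq0; apply: contraT => /rowV0Pn[v /sub_kermxP vM v0].
pose a : E := [tuple v 0 i | i < n].
have : 0 < quadform M a.
  apply: posM; apply: contrapT => a0.
  case/negP: v0; apply/eqP/rowP => i; rewrite mxE; apply: contrapT => vi; apply: a0.
  by exists i; rewrite tnth_mktuple; apply/eqP.
rewrite /quadform exchange_big/= big1 ?ltxx// => j _.
rewrite -mulr_suml; have /rowP/(_ j) := vM; rewrite !mxE => h.
rewrite [X in X * _](_ : _ = 0) ?mul0r// -[RHS]h; apply: eq_bigr => i _.
by rewrite tnth_mktuple.
Qed.

(** Invertibility of [M] lets Cameron-Martin realize every translation; [L], the sum of the absolute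
    entries of the inverse, keeps [s] small when the displacement is small. *)
Lemma mulMt_surj (M : 'M[R]_n) : sym_posdef M -> exists2 L : R, 0 <= L &
  forall u r, (forall i, `|tnth u i| <= r) -> exists2 s, mulMt M s = u & norm1 s <= L * r.
Proof.
move=> /sym_posdef_unit uM; exists (\sum_(i < n) \sum_(j < n) `|invmx M i j|).
  by do 2 apply: sumr_ge0 => ? _.
move=> u r ur; exists [tuple \sum_(j < n) invmx M i j * tnth u j | i < n].
  apply: eq_from_tnth => i; rewrite tnth_mktuple.
  have /colP/(_ i) := mulKVmx uM (\col_k tnth u k); rewrite !mxE => <-.
  apply: eq_bigr => j _; rewrite tnth_mktuple !mxE; congr (_ * _).
  by apply: eq_bigr => k _; rewrite !mxE.
rewrite mulr_suml ler_sum// => i _; rewrite tnth_mktuple mulr_suml.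
apply: le_trans (ler_norm_sum _ _ _) _; apply: ler_sum => j _.
by rewrite normrM ler_wpM2l.
Qed.

Lemma measurable_subt t : measurable_fun setT (subt t).
Proof.
apply/measurable_fun_tnthP => i.
rewrite (_ : _ \o _ = (fun e => tnth t i - tnth e i)); last first.
  by apply/funext => e /=; rewrite tnth_mktuple.
by apply: measurable_funB => //; exact: measurable_tnth.
Qed.

Lemma bounded_wint_integrable (P : probability E R) (M : 'M[R]_n) (X : E -> E)
    (g : E -> R) (K C : R) : sym_posdef M -> is_normal0 P M ->
  measurable_fun setT X -> measurable_fun setT g -> (forall x, `|g x| <= C) ->
  (exists a, forall x, K * norm1 (X x) <= a + `|K| * norm1 x) ->
  P.-integrable setT (fun e => (expR (K * norm1 (X e)) * g e)%:E).
Proof.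
move=> posM normP mX mg gC [a Xa].
have h := integrableZl measurableT (C * expR a) (integrable_exp_norm1 posM normP `|K|).
apply: (le_integrable measurableT _ _ h).
  apply/measurable_EFinP; apply: measurable_funM => //.
  apply: measurableT_comp => //; apply: measurable_funM => //.
  by apply: measurableT_comp mX; exact: measurable_norm1.
move=> e _ /=; rewrite lee_fin; apply: le_trans (ler_norm _).
rewrite normrM ger0_norm ?expR_ge0// mulrC -mulrA -expRD.
by rewrite ler_pM ?expR_ge0// ler_expR.
Qed.

Lemma norm1_subt t u : norm1 (subt t u) <= norm1 t + norm1 u.
Proof.
rewrite /norm1 -big_split ler_sum// => i _ /=; rewrite tnth_mktuple.
by apply: le_trans (ler_normD _ _) _; rewrite normrN.
Qed.

(** By Cameron-Martin, moving [t] by [- M s] amounts to weighting by [exp (lincomb s)]. Vanishing at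
    every [t] thus means that [g (subt t e)] times [P] has zero Laplace transform; uniqueness,
    tested on [g] itself, makes the integral of the square vanish. *)
Theorem normal_law_complete (P : probability E R) (M : 'M[R]_n) (g : E -> R) (C : R)
    (D : set E) : sym_posdef M -> is_normal0 P M ->
  measurable_fun setT g -> (forall x, `|g x| <= C) ->
  (forall c r, 0 < r -> exists2 t, D t & box c r t) ->
  (forall t, D t -> \int[P]_e g (subt t e) = 0) ->
  forall t, {ae P, forall e, g (subt t e) = 0}.
Proof.
move=> posM normP mg gC dD D0.
have mgt t : measurable_fun setT (fun e => g (subt t e)).
  by apply: measurableT_comp => //; exact: measurable_subt.
have shift t s : \int[P]_e g (subt (subt t (mulMt M s)) e) =
    expR (- (quadform M s / 2)) * \int[P]_e (g (subt t e) * expR (lincomb s e)).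
  have := normal_law_shift posM normP s (mgt t) (fun e => gC (subt t e)) => <-.
  apply: eq_Rintegral => e _; congr g; apply: eq_from_tnth => i.
  by rewrite !tnth_mktuple; ring.
have growth0 (K : R) : exists a, forall x : E, K * norm1 x <= a + `|K| * norm1 x.
  by exists 0 => x; rewrite add0r ler_wpM2r ?norm1_ge0// ler_norm.
(* Extension from [D] to every [t] by continuity: points of [D] within [1 / (m + 1)] of [t]
   correspond to weights [s_ m] tending to 0, and dominated convergence gives the integral at
   [t]. *)
have F0 t : \int[P]_e g (subt t e) = 0.
  have [L L0 HL] := mulMt_surj posM.
  have step m : {s | norm1 s <= L / m.+1%:R & \int[P]_e (g (subt t e) * expR (lincomb s e)) = 0}.
    apply/cid2; have [t' Dt' tt'] := dD t m.+1%:R^-1 (ltac:(by rewrite invr_gt0)).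
    have [s sE sL] : exists2 s, mulMt M s = subt t t' & norm1 s <= L * m.+1%:R^-1.
      by apply: HL => i; rewrite tnth_mktuple distrC ltW//; exact: tt'.
    exists s => //; have := shift t s.
    have -> : subt t (mulMt M s) = t'.
      by apply: eq_from_tnth => i; rewrite sE !tnth_mktuple; ring.
    by rewrite D0// => /esym/eqP; rewrite mulf_eq0 gt_eqF ?expR_gt0//= => /eqP.
  pose s_ m := s2val (step m).
  have s_L m : norm1 (s_ m) <= L / m.+1%:R by rewrite /s_; case: (step m).
  have iw (K : R) := bounded_wint_integrable posM normP (@measurable_id _ _ _) (mgt t)
      (fun e => gC (subt t e)) (growth0 K).
  have : wint P id (fun e => g (subt t e)) (fun x => expR (lincomb (s_ m) x)) @[m --> \oo] -->
      wint P id (fun e => g (subt t e)) (fun=> 1).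
    apply: (@wint_cvg _ _ _ _ P id _ (@measurable_id _ _ _) (mgt t) iw _ _ 1 L).
    - by move=> m; exact: measurable_exp_lincomb.
    - move=> m; apply: (dominatedW (dominated_exp (s_ m))) => //.
      by apply: (le_trans (s_L m)); rewrite ler_piMr// invf_le1// ler1n.
    - move=> x; rewrite -expR0; apply: continuous_cvg; first exact: continuous_expR.
      apply/norm_cvg0P.
      apply: (@squeeze_cvgr _ _ _ _ (fun=> 0) (fun m => (L * norm1 x) * m.+1%:R^-1)).
      + apply: nearW => m; rewrite normr_ge0/=.
        apply: (le_trans (norm_lincomb _ _)); rewrite mulrAC ler_wpM2r ?norm1_ge0//.
      + exact: cvg_cst.
      + rewrite -(mulr0 (L * norm1 x)); apply: cvgM; [exact: cvg_cst|exact: cvg_harmonic].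
  rewrite /wint; have -> : (fun m => \int[P]_e (expR (lincomb (s_ m) e) * g (subt t e))) = fun=> 0.
    apply/funext => m; rewrite /s_; case: (step m) => s /= _ <-.
    by apply: eq_Rintegral => e _; rewrite mulrC.
  move=> /(cvg_unique _ (cvg_cst 0)) h; rewrite [RHS]h//.
  by apply: eq_Rintegral => e _; rewrite mul1r.
move=> t.
have growth1 (K : R) : exists a, forall x : E, K * norm1 (subt t x) <= a + `|K| * norm1 x.
  exists (`|K| * norm1 t) => x; rewrite -mulrDr.
  apply: (@le_trans _ _ (`|K| * norm1 (subt t x))).
    by rewrite ler_wpM2r ?norm1_ge0// ler_norm.
  by rewrite ler_wpM2l// norm1_subt.
have c0 x : `|(fun=> 0 : R) (x : E)| <= 0 by rewrite normr0.
(* The image of [g (subt t e)] times [P] under [subt t] is compared with the zero measure, encoded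
   by the weight 0. *)
have := @laplace_uniqueness _ _ _ _ P (subt t) id (fun e => g (subt t e)) (fun=> 0)
  (measurable_subt t) (@measurable_id _ _ _) (mgt t) (measurable_cst _)
  (fun K => bounded_wint_integrable posM normP (measurable_subt t) (mgt t)
     (fun e => gC (subt t e)) (growth1 K))
  (fun K => bounded_wint_integrable posM normP (@measurable_id _ _ _) (measurable_cst _)
     c0 (growth0 K)) g C.
have int0 f : wint P id (fun=> 0) f = 0.
  rewrite /wint; under eq_Rintegral do rewrite mulr0.
  by rewrite Rintegral_cst// mul0r.
move=> /(_ _ mg gC); rewrite int0 => sq0.
have {}sq0 : \int[P]_e (g (subt t e) * g (subt t e)) = 0.
  apply: sq0 => u; rewrite int0 /wint.
  (* [exp (lincomb u (subt t e))] is a constant times [exp (- lincomb u e)], so the shift formula at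
     [- u] applies. *)
  have := shift t (scalet (-1) u); rewrite F0 => /esym/eqP.
  rewrite mulf_eq0 gt_eqF ?expR_gt0//= => /eqP h.
  transitivity (\int[P]_e (expR (lincomb u t) * (g (subt t e) * expR (lincomb (scalet (-1) u) e)))).
    apply: eq_Rintegral => e _; rewrite lincombZl mulrCA -expRD mulrC; congr (_ * expR _).
    rewrite /lincomb mulr_sumr -big_split; apply: eq_bigr => i _ /=.
    by rewrite !tnth_mktuple; ring.
  rewrite RintegralZl// ?h ?mulr0//.
  have := @wint_integrable _ _ _ _ P id (fun e => g (subt t e)) (@measurable_id _ _ _) (mgt t)
    (fun K => bounded_wint_integrable posM normP (@measurable_id _ _ _) (mgt t)
      (fun e => gC (subt t e)) (growth0 K))
    _ (measurable_exp_lincomb (scalet (-1) u)) (exp_growth_exp (scalet (-1) u)).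
  by congr (P.-integrable setT); apply/funext => e /=; rewrite mulrC.
have msq : measurable_fun setT (fun e => g (subt t e) * g (subt t e)).
  by apply: measurable_funM.
have isq : P.-integrable setT (EFin \o (fun e => g (subt t e) * g (subt t e))).
  apply: measurable_bounded_integrable => //.
    exact: le_lt_trans (probability_le1 P measurableT) (ltry _).
  exists (C * C); split; first exact: num_real.
  move=> x Cx e _ /=; apply: le_trans (ltW Cx).
  by rewrite normrM ler_pM.
have mE : measurable_fun setT (EFin \o (fun e => g (subt t e) * g (subt t e))).
  exact/measurable_EFinP.
pose q (e : E) := g (subt t e) * g (subt t e).
have E0 : (\int[P]_e `|(EFin \o q) e| = 0)%E.
  rewrite (eq_integral (EFin \o q)); last first.
    by move=> e _; rewrite gee0_abs// lee_fin /q -expr2 sqr_ge0.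
  rewrite -[LHS](fineK (integrable_fin_num measurableT isq)).
  by congr EFin; exact: sq0.
have [/(_ E0) + _] := ae_eq_integral_abs P measurableT mE.
apply: filterS => e /(_ I) /= [] /eqP; rewrite mulf_eq0 orbb => /eqP.
by [].
Qed.

End Completeness.

(** * Tail estimates *)

Section LawEstimates.
Context (R : realType) (n : nat).
Local Notation E := (n.-tuple R).
Variables (P : probability E R) (M : 'M[R]_n).
Hypotheses (posM : sym_posdef M) (normP : is_normal0 P M).
Implicit Types (s t e : E).

Lemma measurable_coord_set (i : 'I_n) (U : set R) : measurable U ->
  measurable [set e : E | U (tnth e i)].
Proof. by move=> mU; rewrite -[X in measurable X]setTI; exact: measurable_tnth. Qed.

Lemma measurable_norm1_lt (k : R) : measurable [set e : E | norm1 e < k].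
Proof.
rewrite (_ : mkset _ = (@norm1 R n) @^-1` `]-oo, k[); last first.
  by apply/seteqP; split => e /=; rewrite in_itv.
by rewrite -[X in measurable X]setTI; apply: measurable_norm1.
Qed.

Lemma mulMt_axis i j c : tnth (mulMt M (axis i c)) j = M j i * c.
Proof.
rewrite tnth_mktuple (bigD1 i)//= tnth_mktuple eqxx mul1r big1 ?addr0// => k ki.
by rewrite tnth_mktuple (negbTE ki) mul0r mulr0.
Qed.

Lemma quadform_axis i : quadform M (axis i 1) = M i i.
Proof. by rewrite quadform_lincomb lincomb_axis mul1r mulMt_axis mulr1. Qed.

Lemma mulMtD s t : mulMt M (addt s t) = addt (mulMt M s) (mulMt M t).
Proof.
apply: eq_from_tnth => i; rewrite !tnth_mktuple -big_split.
by apply: eq_bigr => j _; rewrite tnth_mktuple mulrDr.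
Qed.

Lemma normal_coord i (U : set R) : M i i = 1 -> measurable U ->
  P [set e | U (tnth e i)] = normal_prob 0 1 U.
Proof.
move=> Mii mU; have := normP (a := axis i 1) _ mU.
rewrite quadform_axis Mii sqrtr1 => <-.
  by congr (P _); apply/funext => e; rewrite /preimage /= lincomb_axis mul1r.
by exists i; rewrite tnth_mktuple eqxx mulr1 oner_eq0.
Qed.

(** Markov's inequality for [exp (norm1 e)], whose mean is [I]: with [k = I / eps],
    [I = eps * k <= eps * exp k]. *)
Lemma normal_law_tight (eps : R) : 0 < eps ->
  exists2 k : R, 0 <= k & (P [set e | (k <= norm1 e)%R] <= eps%:E)%E.
Proof.
move=> eps0; have ie := integrable_exp_norm1 posM normP 1.
pose I := \int[P]_e (expR (1 * norm1 e)).
have I0 : 0 <= I by apply: Rintegral_ge0 => e _; exact: expR_ge0.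
pose k := I / eps; have k0 : 0 <= k by rewrite divr_ge0// ltW.
have mk : measurable [set e : E | (k <= norm1 e)%R].
  rewrite (_ : mkset _ = ~` [set e : E | norm1 e < k]).
    by apply: measurableC; exact: measurable_norm1_lt.
  by apply/seteqP; split => e /=; rewrite leNgt => /negP.
exists k => //; rewrite -[X in P X]setIT -integral_indic//.
apply: (@le_trans _ _ (\int[P]_e ((expR (- k))%:E * (expR (1 * norm1 e))%:E))%E).
  apply: ge0_le_integral => //=.
  - by apply/measurable_EFinP; exact: measurable_indic.
  - apply/measurable_EFinP; apply: measurable_funM => //.
    apply: measurableT_comp => //; apply: measurable_funM => //.
    exact: measurable_norm1.
  - move=> e _; rewrite -EFinM lee_fin -expRD indicE.
    have [ke|_] := boolP (e \in _); last exact: expR_ge0.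
    rewrite inE /= in ke; rewrite mul1r -[leLHS]expR0 ler_expR; lra.
rewrite integralZl//.
rewrite -(fineK (integrable_fin_num measurableT ie)) -EFinM lee_fin.
have h := expR_ge1Dx k.
rewrite expRN mulrC ler_pdivrMr ?expR_gt0//.
apply: (@le_trans _ _ (eps * k)); first by rewrite /k mulrC divfK// gt_eqF.
by rewrite ler_pM2l//; lra.
Qed.

Lemma quadform_axis2 i j (c : R) : i != j -> M i i = 1 -> M j j = 1 ->
  quadform M (addt (axis i c) (axis j c)) = 2 * c ^+ 2 * (1 + M i j).
Proof.
move=> ij Mii Mjj; have symM : M j i = M i j by have [/matrixP /(_ i j) <- _] := posM; rewrite mxE.
rewrite quadform_lincomb mulMtD lincombDl !lincomb_axis.
rewrite [tnth (addt _ _) i]tnth_mktuple [tnth (addt _ _) j]tnth_mktuple !mulMt_axis.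
by rewrite Mii Mjj symM; ring.
Qed.

(** Chernoff bound: the indicator is at most [exp (2 * c * t - c * (e_i + e_j))], whose mean is
    explicit. The tilt [c] is left free until [correlation_le]. *)
Lemma orthant_ub i j (c t : R) : i != j -> M i i = 1 -> M j j = 1 -> 0 <= c ->
  (P [set e | (tnth e i <= t)%R /\ (tnth e j <= t)%R] <=
   (expR (c ^+ 2 * (1 + M i j) + 2 * c * t))%:E)%E.
Proof.
move=> ij Mii Mjj c0; set B := [set e | _].
have mB : measurable B.
  have h k : measurable [set e : E | (tnth e k <= t)%R].
    have := @measurable_coord_set k `]-oo, t]%classic (measurable_itv _).
    by congr measurable; apply/seteqP; split => e /=; rewrite in_itv.
  exact: (measurableI _ _ (h i) (h j)).
pose s := addt (axis i (- c)) (axis j (- c)).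
have ie := integrable_exp_lincomb posM normP s.
rewrite -[X in P X]setIT -integral_indic//.
apply: (@le_trans _ _ (\int[P]_e ((expR (2 * c * t))%:E * (expR (lincomb s e))%:E))%E).
  apply: ge0_le_integral => //=.
  - by apply/measurable_EFinP; exact: measurable_indic.
  - by apply/measurable_EFinP; apply: measurable_funM => //; exact: measurable_exp_lincomb.
  - move=> e _; rewrite -EFinM lee_fin -expRD indicE.
    have [|_] := boolP (e \in _); last exact: expR_ge0.
    rewrite inE => -[ei ej]; rewrite -[leLHS]expR0 ler_expR lincombDl !lincomb_axis.
    have := ler_wpM2l c0 ei; have := ler_wpM2l c0 ej; lra.
rewrite integralZl// (normal_law_mgf posM normP) -EFinM lee_fin -expRD ler_expR.
by rewrite quadform_axis2// sqrrN addrC lerD2r; lra.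
Qed.

Lemma prob_shift s (A : set E) : measurable A ->
  P ((fun e => addt e (mulMt M s)) @^-1` A) =
  ((expR (- (quadform M s / 2)))%:E * \int[P]_e (\1_A e * expR (lincomb s e))%:E)%E.
Proof.
move=> mA; have f1 e : `|\1_A e : R| <= 1.
  by rewrite indicE; case: (_ \in _); rewrite ?normr1 ?normr0.
have mf := measurable_indic mA (R := R) (D := setT).
have cm := normal_law_shift posM normP s mf f1.
have mB : measurable ((fun e => addt e (mulMt M s)) @^-1` A).
  rewrite -[X in measurable X]setTI.
  have /measurable_fun_tnthP : forall l, measurable_fun setT
      ((fun x : E => tnth x l) \o (fun e : E => addt e (mulMt M s))).
    move=> l; rewrite (_ : _ \o _ = (fun e => tnth e l + tnth (mulMt M s) l)); last first.
      by apply/funext => e /=; rewrite tnth_mktuple.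
    by apply: measurable_funD => //; exact: measurable_tnth.
  by apply.
have i1 : P.-integrable setT (fun e => (\1_A e * expR (lincomb s e))%:E).
  apply: (le_integrable measurableT _ _ (integrable_exp_lincomb posM normP s)).
    by apply/measurable_EFinP; apply: measurable_funM => //; exact: measurable_exp_lincomb.
  by move=> e _ /=; rewrite lee_fin normrM ler_piMl.
rewrite -(fineK (integrable_fin_num measurableT i1)) -EFinM -[X in _ * X]/(Rintegral _ _ _).
rewrite -cm /Rintegral fineK.
  rewrite -[X in P X]setIT -integral_indic//.
have -> : (\int[P]_x (\1_A (addt x (mulMt M s)))%:E = 
    \int[P]_x (\1_((fun e => addt e (mulMt M s)) @^-1` A) x)%:E)%E by [].
by rewrite integral_indic// setIT fin_num_measure.
Qed.

(* The mean is tilted to [- c (1 + M i j)] in both coordinates. *)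
Lemma orthant_lb i j (c k : R) : i != j -> M i i = 1 -> M j j = 1 -> 0 <= c ->
  (P [set e | (norm1 e < k)%R] <= (expR (c ^+ 2 * (1 + M i j) + 2 * c * k))%:E *
   P [set e | (tnth e i < - (c * (1 + M i j)) + k)%R /\
              (tnth e j < - (c * (1 + M i j)) + k)%R])%E.
Proof.
move=> ij Mii Mjj c0; set B := [set e | _ /\ _].
have symM : M j i = M i j by have [/matrixP /(_ i j) <- _] := posM; rewrite mxE.
have mB : measurable B.
  have h l : measurable [set e : E | (tnth e l < - (c * (1 + M i j)) + k)%R].
    have := @measurable_coord_set l `]-oo, - (c * (1 + M i j)) + k[%classic (measurable_itv _).
    by congr measurable; apply/seteqP; split => e /=; rewrite in_itv.
  exact: (measurableI _ _ (h i) (h j)).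
pose s := addt (axis i (- c)) (axis j (- c)).
have qs := quadform_axis2 (- c) ij Mii Mjj.
have si : tnth (mulMt M s) i = - (c * (1 + M i j)).
  by rewrite mulMtD tnth_mktuple !mulMt_axis Mii; ring.
have sj : tnth (mulMt M s) j = - (c * (1 + M i j)).
  by rewrite mulMtD tnth_mktuple !mulMt_axis Mjj symM; ring.
(* [A] is the ball of radius [k] about the displaced mean [M s]; it lies in the orthant [B], and
   translation by [M s] pulls it back to the ball about 0. *)
pose A := [set e : E | norm1 (addt e (scalet (-1) (mulMt M s))) < k].
have mA : measurable A.
  have mT : measurable_fun setT (fun e : E => addt e (scalet (-1) (mulMt M s))).
    apply/measurable_fun_tnthP => l.
    rewrite (_ : _ \o _ = (fun e => tnth e l + tnth (scalet (-1) (mulMt M s)) l)); last first.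
      by apply/funext => e /=; rewrite tnth_mktuple.
    by apply: measurable_funD => //; exact: measurable_tnth.
  have := mT measurableT _ (measurable_norm1_lt k).
  by rewrite setTI.
have AB : A `<=` B.
  move=> e Ae; have h l : tnth e l - tnth (mulMt M s) l < k.
    apply: le_lt_trans Ae; apply: le_trans (norm1_coord _ l).
    by rewrite !tnth_mktuple mulN1r ler_norm.
  by split; [have := h i; rewrite si|have := h j; rewrite sj]; lra.
have sA e : A e -> lincomb s e <= 2 * c ^+ 2 * (1 + M i j) + 2 * c * k.
  move=> Ae; have h l : - (tnth e l - tnth (mulMt M s) l) < k.
    apply: le_lt_trans Ae; apply: le_trans (norm1_coord _ l).
    by rewrite !tnth_mktuple mulN1r -normrN ler_norm.
  have := h i; have := h j; rewrite si sj => /ltW/(ler_wpM2l c0) hj /ltW/(ler_wpM2l c0) hi.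
  by rewrite lincombDl !lincomb_axis; lra.
have -> : [set e | (norm1 e < k)%R] = (fun e => addt e (mulMt M s)) @^-1` A.
  apply/seteqP; split => e; rewrite /A /preimage /=;
    have -> // : addt (addt e (mulMt M s)) (scalet (-1) (mulMt M s)) = e;
    by apply: eq_from_tnth => l; rewrite !tnth_mktuple; ring.
rewrite prob_shift// qs.
have -> : (expR (c ^+ 2 * (1 + M i j) + 2 * c * k))%:E =
    ((expR (- (2 * (- c) ^+ 2 * (1 + M i j) / 2)))%:E *
     (expR (2 * c ^+ 2 * (1 + M i j) + 2 * c * k))%:E)%E.
  by rewrite -EFinM -expRD; congr (expR _)%:E; rewrite sqrrN; field.
rewrite -muleA lee_pmul2l ?lte_fin ?expR_gt0//.
rewrite -[X in P X]setIT -integral_indic// -ge0_integralZl//=; last first.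
  by apply/measurable_EFinP; exact: measurable_indic.
apply: ge0_le_integral => //=.
- apply/measurable_EFinP; apply: measurable_funM; first exact: measurable_indic.
  exact: measurable_exp_lincomb.
- apply: emeasurable_funM => //; apply/measurable_EFinP; exact: measurable_indic.
- move=> e _; rewrite -EFinM lee_fin !indicE.
  have [|_] := boolP (e \in A); last by rewrite mul0r mulr_ge0 ?expR_ge0.
  rewrite inE => Ae; rewrite mem_set; last exact: AB.
  by rewrite mul1r mulr1 ler_expR sA.
Qed.

End LawEstimates.

(** If [M i j] exceeded [M' i j] by [d], the two orthant bounds with one tilt [c], at level
    [- c * (1 + M i j) + k], would combine to [1 / 2 <= exp (c * K - c ^ 2 * d)], which fails for
    large [c]. *)
Lemma correlation_le (R : realType) (n : nat) (P P' : probability (n.-tuple R) R)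
    (M M' : 'M[R]_n) (i j : 'I_n) (C : R) :
  sym_posdef M -> is_normal0 P M -> sym_posdef M' -> is_normal0 P' M' ->
  i != j -> M i i = 1 -> M j j = 1 -> M' i i = 1 -> M' j j = 1 ->
  (forall t, P [set e | (tnth e i < t)%R /\ (tnth e j < t)%R] <=
     P' [set e | (tnth e i <= t + C)%R /\ (tnth e j <= t + C)%R])%E ->
  M i j <= M' i j.
Proof.
move=> posM normP posM' normP' ij Mi Mj Mi' Mj' PP'; rewrite leNgt; apply/negP => MM'.
have half0 : 0 < 2^-1 :> R by lra.
have [k k0 Pk] := normal_law_tight posM normP half0.
pose d := M i j - M' i j; pose K := 2 * (2 * k + `|C|).
have d0 : 0 < d by rewrite subr_gt0.
have K0 : 0 <= K by rewrite mulr_ge0// addr_ge0// mulr_ge0.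
(* Chosen so that [c >= 1] and [c * d >= K + 2]: the exponent is then at most [- 2], and
   [exp (- 2) < 1 / 2]. *)
pose c := (K + 2) / d + 1.
have c1 : 1 <= c by rewrite lerDr divr_ge0// ?ltW//; lra.
have cd : K + 2 <= c * d by rewrite mulrDl divfK ?gt_eqF//; lra.
have c0 : 0 <= c by lra.
have Pk' : (2^-1%:E <= P [set e | (norm1 e < k)%R])%E.
  have -> : [set e : n.-tuple R | (norm1 e < k)%R] = ~` [set e | (k <= norm1 e)%R].
    by apply/seteqP; split => e /=; rewrite ltNge => /negP.
  have mk : measurable [set e : n.-tuple R | (k <= norm1 e)%R].
    rewrite (_ : mkset _ = ~` [set e : n.-tuple R | norm1 e < k]).
      by apply: measurableC; exact: measurable_norm1_lt.
    by apply/seteqP; split => e /=; rewrite leNgt => /negP.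
  rewrite probability_setC//.
  move: Pk; rewrite -(fineK (fin_num_measure P _ mk)) -EFinB !lee_fin; lra.
have := le_trans Pk' (orthant_lb posM normP k ij Mi Mj c0).
apply/negP; rewrite -ltNge.
apply: le_lt_trans (lee_wpmul2l _ (PP' _)) _; first by rewrite lee_fin expR_ge0.
apply: le_lt_trans (lee_wpmul2l _ (orthant_ub posM' normP' _ ij Mi' Mj' c0)) _.
  by rewrite lee_fin expR_ge0.
rewrite -EFinM lte_fin -expRD.
apply: (@le_lt_trans _ _ (expR (- 2))).
  rewrite ler_expR.
  have h1 : c * (K + 2) <= c * (c * d) by rewrite ler_wpM2l.
  have h2 : c * C <= c * `|C| by rewrite ler_wpM2l// ler_norm.
  have h3 : 1 * 2 <= c * 2 by rewrite ler_wpM2r.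
  rewrite /K /d in h1 *; rewrite !expr2; lra.
rewrite expRN ltf_pV2 ?posrE ?expR_gt0//; have := @expR_ge1Dx R 2; lra.
Qed.

(** * Rationalizable play *)

Section BinaryGame.
Context (R : realType) (n : nat).
Implicit Types (y : profile n) (i j : 'I_n) (a b : bool).

(* [c i y] is the gain of player [i] from playing [1] against [y]. *)
Variable c : 'I_n -> profile n -> R.
Hypothesis c_minus : forall i y y', same_minus i y y' -> c i y = c i y'.

Let u i y := (y i)%:R * c i y.

(** When playing 1 gains [x], the action [a] does strictly worse than the other action. *)
Definition beaten a (x : R) := if a then x < 0 else 0 < x.

Lemma same_minus_setp i y b : same_minus i y (setp y i b).
Proof. by move=> j ji; rewrite ffunE (negbTE ji). Qed.

Lemma setpE i y b : setp y i b i = b.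
Proof. by rewrite ffunE eqxx. Qed.

Lemma beaten_lt i y a : y i = a -> beaten a (c i y) -> u i y < u i (setp y i (~~ a)).
Proof.
move=> yi; rewrite /u setpE yi -(c_minus (same_minus_setp y (~~ a))).
by case: a {yi} => /=; rewrite ?mul1r ?mul0r.
Qed.

Lemma surv_dominated k i a b : surv u k i b ->
  (forall y, y i = a -> (forall j, j != i -> surv u k j (y j)) -> u i y < u i (setp y i b)) ->
  surv u k.+1 i a = false.
Proof.
move=> sb dom /=; apply/negbTE; rewrite negb_and; apply/orP; right; rewrite negbK.
apply/existsP; exists b; rewrite sb/=; apply/forallP => y; apply/implyP.
move=> /andP[/eqP yi /forallP yj]; apply: dom => // j ji.
by have /implyP/(_ ji) := yj j.
Qed.

Lemma surv1_beaten i a : (forall y, beaten a (c i y)) -> surv u 1 i a = false.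
Proof.
by move=> ba; apply: (@surv_dominated 0 i a (~~ a)) => // y yi _; exact: beaten_lt.
Qed.

(** The first round leaves each opponent [j] at most the action [y0 j], so in the second round
    player [i] compares actions against [y0] alone. *)
Lemma surv2_beaten i a y0 :
  (forall j, j != i -> forall y, beaten (~~ y0 j) (c j y)) ->
  beaten a (c i y0) -> surv u 2 i a = false.
Proof.
move=> others bi; apply: (@surv_dominated 1 i a (~~ a)).
  (* The dominating action [~~ a] survives the first round: it does strictly better than [a] against
     [y0], so it is not dominated. *)
  rewrite /=; apply/existsP => -[b /forallP /(_ (setp y0 i (~~ a)))].
  rewrite setpE eqxx/= => /implyP h.
  have {h} : u i (setp y0 i (~~ a)) < u i (setp (setp y0 i (~~ a)) i b).
    by apply: h; apply/forallP => j; rewrite implybT.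
  rewrite /u !setpE -(c_minus (same_minus_setp _ b)) -(c_minus (same_minus_setp _ _)).
  move: bi; rewrite /beaten; case: a; case: b => /=; rewrite ?mul1r ?mul0r ?ltxx//.
    by move=> /ltW; rewrite leNgt => /negbTE ->.
  by move=> /ltW; rewrite leNgt => /negbTE ->.
move=> y yi yj; apply: beaten_lt => //; rewrite (@c_minus _ _ y0)// => j ji.
apply/eqP; apply: contraT => yy0; have := yj j ji.
have -> : y j = ~~ y0 j by move: yy0; case: (y j); case: (y0 j).
by rewrite surv1_beaten//; exact: others.
Qed.

Lemma rationalizable1 i a y : (forall y', beaten a (c i y')) ->
  rationalizable u y -> y i = ~~ a.
Proof.
move=> /surv1_beaten sa /(_ 1 i) sy; apply/eqP; apply: contraT => ya.
by have ya' : y i = a; [move: ya; case: (y i); case: a {sa}|rewrite ya' sa in sy].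
Qed.

Lemma rationalizable2 i a y0 y :
  (forall j, j != i -> forall y', beaten (~~ y0 j) (c j y')) ->
  beaten a (c i y0) -> rationalizable u y -> y i = ~~ a.
Proof.
move=> others bi /(_ 2 i); have sa := surv2_beaten others bi.
case yi: (y i); case: a sa {bi} => // sa; by rewrite sa.
Qed.

End BinaryGame.

(** * Comparison of outcome probabilities *)

Section Sandwich.
Context (R : realType) (n dW : nat).
Variables (G : 'M[R]_n -> probability (n.-tuple R) R).
Implicit Types (th : param R n dW) (h : dplay R n dW) (x : n.-tuple R * dW.-tuple R).

Lemma measurable_play h x y : in_H h -> measurable_fun setT (h y x).
Proof.
move=> [mh _ _]; have := mh y => mhy.
exact: (measurableT_comp mhy (pair1_measurable x)).
Qed.

Lemma sum_condE th h x (Y : pred (profile n)) : in_H h ->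
  (\sum_(y | Y y) condE G th h x y =
   \int[G (Sigma th x.2)]_e (\sum_(y | Y y) h y x e)%:E)%E.
Proof.
move=> hH; have [_ h01 _] := hH.
rewrite -big_filter -ge0_integral_sum//; last 2 first.
- by move=> y; apply/measurable_EFinP; exact: measurable_play.
- by move=> y e _; rewrite lee_fin; have /andP[] := h01 y x e.
by apply: eq_integral => e _; rewrite big_filter sumEFin.
Qed.

(** The probability of [Y] is the same under both pairs. Given the shocks, it is at least the
    indicator of [A] under [h], which plays only [Y] there, and at most the indicator of [B] under
    [h']. *)
Lemma condE_sandwich th h th' h' x (Y : pred (profile n)) (A B : set (n.-tuple R)) :
  in_H h -> in_H h' -> measurable A -> measurable B ->
  (forall y, condE G th h x y = condE G th' h' x y) ->
  (forall e y, A e -> 0 < h y x e -> Y y) ->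
  (forall e y, Y y -> 0 < h' y x e -> B e) ->
  (G (Sigma th x.2) A <= G (Sigma th' x.2) B)%E.
Proof.
move=> hH hH' mA mB hh' AY YB; have [_ h01 h1] := hH; have [_ h01' h1'] := hH'.
have ms h0 : in_H h0 -> measurable_fun setT (fun e => \sum_(y | Y y) h0 y x e).
  move=> H0; rewrite (_ : (fun e => _) = (fun e => \sum_(y <- index_enum _) if Y y then h0 y x e else 0)).
    by apply: measurable_sum => y; case: (Y y) => //; exact: measurable_play.
  by apply/funext => e; rewrite big_mkcond.
apply: (@le_trans _ _ (\sum_(y | Y y) condE G th h x y)%E).
  rewrite sum_condE// -{1}(setIT A) -integral_indic//.
  apply: ge0_le_integral => //=.
  - by apply/measurable_EFinP; exact: measurable_indic.
  - by apply/measurable_EFinP; exact: ms.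
  - move=> e _; rewrite lee_fin indicE; have [|_] := boolP (e \in A); last first.
      by apply: sumr_ge0 => y _; have /andP[] := h01 y x e.
    rewrite inE => Ae; rewrite -(h1 x e) big_mkcond [leRHS]big_mkcond/=.
    apply: ler_sum => y _; case: ifPn => // nY.
    by rewrite leNgt; apply: contra nY => /AY; apply.
rewrite (eq_bigr _ (fun y _ => hh' y)) sum_condE// -{1}(setIT B) -integral_indic//.
apply: ge0_le_integral => //=.
- by move=> e _; rewrite lee_fin; apply: sumr_ge0 => y _; have /andP[] := h01' y x e.
- by apply/measurable_EFinP; exact: ms.
- by apply/measurable_EFinP; exact: measurable_indic.
- move=> e _; rewrite lee_fin indicE.
  have [[y Yy hy]|nY] := pselect (exists2 y, Y y & 0 < h' y x e).
    rewrite mem_set; last exact: YB hy.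
    rewrite -(h1' x e) big_mkcond; apply: ler_sum => y' _; case: ifPn => // _.
    by have /andP[] := h01' y' x e.
  rewrite big1 ?ler0n// => y Yy; apply/eqP; rewrite eq_le.
  have /andP[-> _] := h01' y x e; rewrite andbT leNgt; apply/negP => hy.
  by apply: nY; exists y.
Qed.

End Sandwich.

(** * Identification at a fixed [w] *)

Section Identification.
Context (R : realType) (n dW : nat).
Local Notation E := (n.-tuple R).
Variables (G : 'M[R]_n -> probability E R).
Hypothesis hG : forall M : 'M[R]_n, sym_posdef M -> is_normal0 (G M) M.
Variable w : dW.-tuple R.
Implicit Types (th : param R n dW) (h : dplay R n dW) (z e : E).

Definition admissible th h :=
  [/\ in_Theta th, in_H h & S_R th h] /\
  [/\ forall i, beta th i w != 0, sym_posdef (Sigma th w) & forall i, Sigma th w i i = 1].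

Definition dense_set (D : set E) := forall c r, 0 < r -> exists2 t, D t & box c r t.

Definition same_outcome th h th' h' z :=
  forall y, condE G th h (z, w) y = condE G th' h' (z, w) y.

(** Since no [b i] vanishes, the indices [b i * z_i] can be steered near any target as freely as [z]
    itself. *)
Lemma dense_set_scale (b : 'I_n -> R) (D : set E) : (forall i, b i != 0) -> dense_set D ->
  dense_set [set s | exists2 z, D z & s = [tuple b i * tnth z i | i < n]].
Proof.
move=> b0 dD c r r0; pose B := 1 + \sum_(i < n) `|b i|.
have B0 : 0 < B by rewrite ltr_wpDr// sumr_ge0.
have bB i : `|b i| <= B.
  by rewrite /B (bigD1 i)//= addrCA lerDl addr_ge0// sumr_ge0.
have [z Dz zr] := dD [tuple tnth c i / b i | i < n] (r / B) (divr_gt0 r0 B0).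
exists [tuple b i * tnth z i | i < n]; first by exists z.
move=> i; have := zr i; rewrite !tnth_mktuple => zi.
have -> : b i * tnth z i - tnth c i = b i * (tnth z i - tnth c i / b i).
  by rewrite mulrBr mulrCA divff// mulr1.
rewrite normrM; apply: (@le_lt_trans _ _ (B * `|tnth z i - tnth c i / b i|)).
  by rewrite ler_wpM2r.
by rewrite mulrC -ltr_pdivlMr.
Qed.

Lemma alpha_bound th th' : exists2 C, 0 <= C &
  forall i y, `|alpha th i y w| <= C /\ `|alpha th' i y w| <= C.
Proof.
pose F i y := `|alpha th i y w| + `|alpha th' i y w|.
have F0 i y : 0 <= F i y by rewrite addr_ge0.
exists (\sum_i \sum_y F i y); first by do 2 apply: sumr_ge0 => ? _.
move=> i y; have Fi : F i y <= \sum_i \sum_y F i y.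
  rewrite (bigD1 i)//= (bigD1 y)//= -addrA lerDl addr_ge0// sumr_ge0// => j _.
  by apply: sumr_ge0.
by split; apply: le_trans Fi; rewrite ?lerDl ?lerDr.
Qed.

Definition gain th z e i (y : profile n) :=
  alpha th i y w + beta th i w * tnth z i - tnth e i.

Lemma gain_minus th z e i y y' : in_Theta th -> same_minus i y y' ->
  gain th z e i y = gain th z e i y'.
Proof. by move=> [_ am _ _] yy'; rewrite /gain (am i y y'). Qed.

Lemma play1 th h z e y i a : admissible th h -> 0 < h y (z, w) e ->
  (forall y', beaten a (gain th z e i y')) -> y i = ~~ a.
Proof.
move=> [[Th _ SR] _] hy ba.
apply: (rationalizable1 (c := gain th z e)) ba _ => [|]; last exact: SR hy.
by move=> *; exact: gain_minus.
Qed.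

Lemma play2 th h z e y (y0 : profile n) i a : admissible th h -> 0 < h y (z, w) e ->
  (forall j, j != i -> forall y', beaten (~~ y0 j) (gain th z e j y')) ->
  beaten a (gain th z e i y0) -> y i = ~~ a.
Proof.
move=> [[Th _ SR] _] hy others bi.
apply: (rationalizable2 (c := gain th z e)) others bi _ => [|]; last exact: SR hy.
by move=> *; exact: gain_minus.
Qed.

Lemma normal_prob_ray_le (p q : R) :
  (normal_prob 0 1 `]-oo, p[ <= normal_prob 0 1 `]-oo, q])%E -> p <= q.
Proof.
move=> pq; rewrite leNgt; apply/negP => qp.
have := normal_prob_itv_gt0 0 (oner_neq0 R) qp.
have sub : `]q, p[%classic = `]-oo, p[ `\` `]-oo, q] :> set R.
  apply/seteqP; split => x /=; rewrite !in_itv/=.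
    by move=> /andP[qx ->]; split=> //; rewrite leNgt qx.
  by move=> [-> /negP]; rewrite -ltNge andbT.
rewrite sub measureD//=; last exact: le_lt_trans (probability_le1 _ _) (ltry _).
rewrite (_ : _ `&` _ = `]-oo, q]%classic).
  by rewrite sube_gt0 ltNge pq.
by apply/setIidPr => x /=; rewrite !in_itv/= => xq; exact: le_lt_trans qp.
Qed.

Lemma coord_prob th h i (U : set R) : admissible th h -> measurable U ->
  G (Sigma th w) [set e | U (tnth e i)] = normal_prob 0 1 U.
Proof.
by move=> [_ [_ pos diag]] mU; apply: (normal_coord (hG pos)).
Qed.

(** Action 1 is strictly dominant under [th] when [e_i] is below the left side, and strictly
    dominated under [th'] when [e_i] is above the right side; [e_i] is standard normal in both
    cases. *)
Lemma beta_bound th h th' h' z i C : admissible th h -> admissible th' h' ->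
  same_outcome th h th' h' z ->
  (forall i y, `|alpha th i y w| <= C /\ `|alpha th' i y w| <= C) ->
  beta th i w * tnth z i - C <= beta th' i w * tnth z i + C.
Proof.
move=> A A' zz' aC; apply: normal_prob_ray_le.
rewrite -(coord_prob i A)// -(coord_prob i A')//.
have [[_ hH _] _] := A; have [[_ hH' _] _] := A'.
apply: (condE_sandwich (x := (z, w)) (Y := fun y => y i) hH hH') => //.
- exact: measurable_coord_set.
- exact: measurable_coord_set.
- move=> e y /=; rewrite in_itv/= => ei hy.
  rewrite (play1 (i := i) (a := false) A hy)// => y' /=.
  by have [+ _] := aC i y'; rewrite ler_norml /gain => /andP[? ?]; lra.
- move=> e y yi hy /=; rewrite in_itv/= leNgt; apply/negP => ei.
  suff /(play1 A' hy) : forall y', beaten true (gain th' z e i y') by rewrite yi.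
  move=> y' /=.
  by have [_] := aC i y'; rewrite ler_norml /gain => /andP[? ?]; lra.
Qed.

Section Pair.
Variables (th th' : param R n dW) (h h' : dplay R n dW).
Hypotheses (A : admissible th h) (A' : admissible th' h').
Hypothesis dense : dense_set (same_outcome th h th' h').

Lemma beta_identified i : beta th i w = beta th' i w.
Proof.
have [C C0 aC] := alpha_bound th th'.
pose d := beta th i w - beta th' i w.
apply/eqP; rewrite -subr_eq0 -/d; apply/negPn/negP => d0.
(* This radius puts [d * z_i] within [1 / 2] of [2 * C + 1], hence above the [2 * C] allowed by
   [beta_bound]. *)
have r0 : 0 < (2 * `|d|)^-1 by rewrite invr_gt0 mulr_gt0// normr_gt0.
have [z Qz zc] := dense [tuple (2 * C + 1) / d | i < n] r0.
have := beta_bound i A A' Qz aC.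
have /(_ i) := zc; rewrite tnth_mktuple => zi.
have : `|d * (tnth z i - (2 * C + 1) / d)| < 2^-1.
  by rewrite normrM mulrC -ltr_pdivlMr ?normr_gt0// -invfM.
rewrite mulrBr [d * (_ / _)]mulrCA divff// mulr1 ltr_norml => /andP[h1 h2].
by rewrite /d in h1 h2; lra.
Qed.

Lemma Sigma_le i j : i != j -> Sigma th w i j <= Sigma th' w i j.
Proof.
move=> ij; have [[_ hH _] [b0 pos diag]] := A; have [[_ hH' _] [_ pos' diag']] := A'.
have [C C0 aC] := alpha_bound th th'.
apply: (correlation_le (C := 2 * C + 2) pos (hG pos) pos' (hG pos') ij) => // t.
(* All indices lie in [[t + C, t + C + 2]]: shocks below [t] make 1 dominant under [th], and shocks
   above [t + 2 * C + 2] make it dominated under [th']. *)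
have [_ [z Qz ->] zt] := dense_set_scale b0 dense [tuple t + C + 1 | k < n] ltr01.
have {}zt k : t + C <= beta th k w * tnth z k <= t + C + 2.
  by have := zt k; rewrite !tnth_mktuple ltr_norml => /andP[? ?]; apply/andP; split; lra.
have mlt k : measurable [set e : E | (tnth e k < t)%R].
  have := @measurable_coord_set R n k `]-oo, t[%classic (measurable_itv _).
  by congr measurable; apply/seteqP; split => e /=; rewrite in_itv.
have mle k : measurable [set e : E | (tnth e k <= t + (2 * C + 2))%R].
  have := @measurable_coord_set R n k `]-oo, t + (2 * C + 2)]%classic (measurable_itv _).
  by congr measurable; apply/seteqP; split => e /=; rewrite in_itv.
apply: (condE_sandwich (x := (z, w)) (Y := fun y => y i && y j) hH hH') => //.
- exact: (measurableI _ _ (mlt i) (mlt j)).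
- exact: (measurableI _ _ (mle i) (mle j)).
- move=> e y [ei ej] hy.
  have one k : tnth e k < t -> y k.
    move=> ek; rewrite (play1 (i := k) (a := false) A hy)// => y' /=.
    by have [+ _] := aC k y'; have := zt k; rewrite ler_norml /gain => /andP[? ?] /andP[? ?]; lra.
  by rewrite !one.
- move=> e y /andP[yi yj] hy.
  have one k : y k -> tnth e k <= t + (2 * C + 2).
    move=> yk; rewrite leNgt; apply/negP => ek.
    suff /(play1 A' hy) : forall y', beaten true (gain th' z e k y') by rewrite yk.
    move=> y' /=.
    have [_] := aC k y'; have := zt k; rewrite /gain -beta_identified ler_norml.
    by move=> /andP[? ?] /andP[? ?]; lra.
  by split; exact: one.
Qed.

(* Each [z_j] with [j != i] is taken so large (in the right direction) that playing [y0 j] is dominant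
   for every [j != i]; player [i] then faces a known action profile. *)
Lemma alpha_le i (y0 : profile n) : alpha th i y0 w <= alpha th' i y0 w.
Proof.
have [[Th hH _] [b0 pos diag]] := A; have [[Th' hH' _] [_ pos' diag']] := A'.
have [C C0 aC] := alpha_bound th th'.
rewrite leNgt; apply/negP; set a := alpha th i y0 w; set a' := alpha th' i y0 w => aa'.
(* The margin [d] absorbs the index of player [i] and leaves between [a' + d] and [a - d] an
   interval of positive probability [eta]; the two tails cut off below cost at most [eta / 3]
   each. *)
pose d := (a - a') / 4; have d0 : 0 < d by rewrite divr_gt0// subr_gt0.
have adad : a' + d < a - d by rewrite /d; lra.
have eta0 := normal_prob_itv_gt0 0 (oner_neq0 R) adad.
pose eta := fine (normal_prob 0 1 `]a' + d, a - d[ : \bar R).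
have etaE : normal_prob 0 1 `]a' + d, a - d[ = eta%:E by rewrite fineK// fin_num_measure.
have {eta0} eta0 : 0 < eta by rewrite -lte_fin -etaE.
have eta30 : 0 < eta / 3 by rewrite divr_gt0.
have [k1 k10 tail1] := normal_law_tight pos (hG pos) eta30.
have [k2 k20 tail2] := normal_law_tight pos' (hG pos') eta30.
(* [K] adds up the bounds on shocks, on [alpha] and on the approximation error, so it fixes the sign
   of the opponents' gains. *)
pose k := k1 + k2; pose K := k + C + d.
have [_ [z Qz ->] zt] := dense_set_scale b0 dense
  [tuple if j == i then 0 else if y0 j then K else - K | j < n] d0.
have zi : - d < beta th i w * tnth z i < d.
  by have := zt i; rewrite !tnth_mktuple eqxx subr0 ltr_norml.
have zj j : j != i -> if y0 j then k + C < beta th j w * tnth z j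
                      else beta th j w * tnth z j < - (k + C).
  move=> ji; have := zt j; rewrite !tnth_mktuple (negbTE ji) ltr_norml.
  by case: (y0 j) => /andP[h1 h2]; rewrite /K in h1 h2; lra.
have others th0 e : (forall j, beta th0 j w = beta th j w) ->
  (forall j y, `|alpha th0 j y w| <= C) -> norm1 e < k ->
  forall j, j != i -> forall y', beaten (~~ y0 j) (gain th0 z e j y').
  move=> bb aC0 ek j ji y'; have := zj j ji; have := aC0 j y'; rewrite /gain bb.
  have := le_lt_trans (norm1_coord e j) ek.
  by rewrite ltr_norml ler_norml => /andP[? ?] /andP[? ?]; case: (y0 j) => /= ?; lra.
pose T := [set e : E | norm1 e < k].
have mT : measurable T by exact: measurable_norm1_lt.
pose U := [set e : E | `]-oo, a - d[%classic (tnth e i)].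
pose V := [set e : E | `]-oo, a' + d]%classic (tnth e i)].
have mU : measurable U by exact: measurable_coord_set.
have mV : measurable V by exact: measurable_coord_set.
have tailT th0 k0 : k0 <= k ->
  (G (Sigma (th0 : param R n dW) w) [set e | (k0 <= norm1 e)%R] <= (eta / 3)%:E)%E ->
  (G (Sigma th0 w) (~` T) <= (eta / 3)%:E)%E.
  move=> k0k; apply: le_trans; apply: le_measure; rewrite ?inE.
  - exact: measurableC.
  - rewrite (_ : mkset _ = ~` [set e : E | norm1 e < k0]).
      by apply: measurableC; exact: measurable_norm1_lt.
    by apply/seteqP; split => e /=; rewrite leNgt => /negP.
  - move=> e /= /negP; rewrite -leNgt; exact: le_trans.
have kk1 : k1 <= k by rewrite lerDl.
have kk2 : k2 <= k by rewrite lerDr.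
have {tail1} tail1 := tailT _ _ kk1 tail1.
have {tail2} tail2 := tailT _ _ kk2 tail2.
(* On [T] the opponents play [y0]. The profile where [i] adds action 1 is then certain under [th] if
   [e_i < a - d], and possible under [th'] only if [e_i <= a' + d]. *)
have main : (G (Sigma th w) (U `&` T) <= G (Sigma th' w) (V `|` ~` T))%E.
  apply: (condE_sandwich (x := (z, w)) (Y := pred1 (setp y0 i true)) hH hH') => //.
  - exact: measurableI.
  - by apply: measurableU => //; exact: measurableC.
  - move=> e y [+ Te] hy; rewrite /U /= in_itv/= => ei.
    have oth := others th e (fun=> erefl) (fun j y => (aC j y).1) Te.
    apply/eqP/ffunP => j; rewrite ffunE; case: eqP => [->|/eqP ji].
      rewrite (play2 (y0 := y0) (a := false) A hy)//=.
      by rewrite /gain -/a; lra.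
    by rewrite (play1 (a := ~~ y0 j) A hy) ?negbK//; exact: oth.
  - move=> e y /eqP yE hy; have [Te|nTe] := pselect (T e); [left|by right].
    rewrite /V /= in_itv/= leNgt; apply/negP => ei.
    have oth := others th' e (fun j => esym (beta_identified j)) (fun j y => (aC j y).2) Te.
    suff /(play2 A' hy oth) : beaten true (gain th' z e i y0) by rewrite yE setpE.
    by rewrite /= /gain -beta_identified -/a'; lra.
have hU : G (Sigma th w) U = normal_prob 0 1 `]-oo, a - d[ by exact: coord_prob A _.
have hV : G (Sigma th' w) V = normal_prob 0 1 `]-oo, a' + d] by exact: coord_prob A' _.
have h1 : (G (Sigma th w) U <= G (Sigma th w) (U `&` T) + G (Sigma th w) (~` T))%E.
  have mTC := measurableC mT.
  apply: le_trans (measureU2 _ _ _) => //; last exact: measurableI.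
  apply: le_measure; rewrite ?inE//; first by apply: measurableU => //; exact: measurableI.
  by move=> e Ue; have [Te|nTe] := pselect (T e); [left|right].
have h2 : (G (Sigma th' w) (V `|` ~` T) <= G (Sigma th' w) V + G (Sigma th' w) (~` T))%E.
  by apply: measureU2 => //; exact: measurableC.
have h3 : (normal_prob 0 1 `]-oo, (a - d)%R[ = normal_prob 0 1 `]-oo, (a' + d)%R] + eta%:E)%E.
  rewrite -etaE -measureU//=.
    congr (normal_prob _ _ _); apply/seteqP; split => x /=; rewrite !in_itv/=.
      by move=> xa; rewrite xa andbT; apply/orP; case: leP.
    by move=> []; [move=> xa; exact: le_lt_trans adad|case/andP].
  by apply/seteqP; split => // x [] /=; rewrite !in_itv/= => xa /andP[]; rewrite ltNge xa.
have := le_trans h1 (leeD main tail1).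
move/le_trans/(_ (leeD (le_trans h2 (leeD (lexx _) tail2)) (lexx _))).
rewrite hU hV h3 -(fineK (fin_num_measure (normal_prob 0 1) _ (measurable_itv `]-oo, (a' + d)%R]))).
by rewrite -!EFinD lee_fin; lra.
Qed.

End Pair.
End Identification.

(** * Supports and dense sets *)

Section Support.
Context (R : realType) (k : nat).
Local Notation E := (k.-tuple R).

Lemma measurable_box (c : E) (r : R) : measurable (box c r).
Proof.
rewrite (_ : box c r = \bigcap_(i in [set: 'I_k])
    ((fun v : E => tnth v i) @^-1` `](tnth c i - r), (tnth c i + r)[)); last first.
  apply/seteqP; split => v /= vc => [i _|i].
    by have := vc i; rewrite /= in_itv/= ltr_distl.
  by have := vc i I; rewrite /= in_itv/= ltr_distl.
apply: fin_bigcap_measurable => // i _; rewrite -[X in measurable X]setTI.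
exact: measurable_tnth.
Qed.

(** A point outside the support lies in a null box with rational centre and radius [1 / (l + 1)],
    and there are countably many such boxes. *)
Lemma ae_support (mu : probability E R) : {ae mu, forall c, Defs.support mu c}.
Proof.
(* Numbers that code no box, or a box of positive measure, contribute the empty set. *)
pose F (m : nat) := if unpickle m is Some (q, l) then
    let B := box [tuple ratr (tnth (q : k.-tuple rat) i) | i < k] (l.+1%:R^-1) in
    if mu B == 0%E then B else set0
  else set0.
have F0 m : mu.-negligible (F m).
  rewrite /F; case: unpickle => [[q l]|]; last exact: negligible_set0.
  case: ifPn => [/eqP B0|_]; last exact: negligible_set0.
  by apply/negligibleP => //; exact: measurable_box.
apply: negligibleS (negligible_bigcup F0) => c /= /existsNP[r /not_implyP[r0 /negP]].
rewrite lt0e measure_ge0 andbT negbK => /eqP cr.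
have [l lr] := filter_ex (nbhs_infty_gtr (2 / r)).
have d0 : (0 : R) < l.+1%:R^-1 by rewrite invr_gt0.
(* Two small radii fit into [r], so a small box containing [c] is inside the null [box c r]. *)
have dr : 2 * l.+1%:R^-1 <= r.
  rewrite ler_pdivrMr// mulrC -ler_pdivrMr//; apply: ltW; apply: lt_trans lr _.
  by rewrite ltr_nat.
have /choice[q qc] (i : 'I_k) : exists q : rat, `|tnth c i - ratr q| < l.+1%:R^-1.
  have ci : tnth c i - l.+1%:R^-1 < tnth c i + l.+1%:R^-1.
    by rewrite ltrD2l gtrN.
  have [q] := rat_in_itvoo ci; rewrite in_itv/= => /andP[q1 q2]; exists q.
  by rewrite distrC ltr_distl q1 q2.
exists (pickle ([tuple q i | i < k], l)) => //; rewrite /F pickleK.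
set B := box _ _; have Bc : B c by move=> i; rewrite !tnth_mktuple.
suff /eqP -> : mu B = 0%E by rewrite ?eqxx.
apply/eqP; rewrite -measure_le0 -cr; apply: le_measure; rewrite ?inE; try exact: measurable_box.
move=> v Bv i; have := Bv i; have := Bc i; rewrite !tnth_mktuple.
move: dr d0; set d := l.+1%:R^-1 => dr d0.
by rewrite !ltr_norml => /andP[? ?] /andP[? ?]; apply/andP; split; lra.
Qed.

(** Under full support every box has positive measure, so none fits in the exceptional null set. *)
Lemma support_dense (mu : {measure set E -> \bar R}) (D : set E) :
  Defs.support mu = setT -> {ae mu, forall c, D c} -> dense_set D.
Proof.
move=> mT [N [mN N0 DN]] c r r0.
have : Defs.support mu c by rewrite mT.
move=> /(_ r r0) br; apply: contrapT => noD.
have : (mu (box c r) <= mu N)%E.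
  apply: le_measure; rewrite ?inE//; first exact: measurable_box.
  by move=> v cv; apply: DN => Dv; apply: noD; exists v.
by rewrite N0 leNgt br.
Qed.

End Support.

(** * Identification of the distribution of play *)

Section Clip.
Context (R : realType).

(** Completeness asks for a bounded function, whereas the [ht] of A3 is merely measurable; clipping
    bounds it and leaves it unchanged where it equals a probability. *)
Definition clip (x : R) := Num.max 0 (Num.min 1 x).

Lemma clip_id x : 0 <= x <= 1 -> clip x = x.
Proof. by move=> /andP[x0 x1]; rewrite /clip (min_idPr x1) (max_idPr x0). Qed.

Lemma clip_bound x : 0 <= clip x <= 1.
Proof. by rewrite /clip le_max lexx/= ge_max ler01 ge_min lexx. Qed.

Lemma measurable_clip d (T : measurableType d) (f : T -> R) :
  measurable_fun setT f -> measurable_fun setT (fun x => clip (f x)).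
Proof. by move=> mf; apply: measurable_maxr => //; exact: measurable_minr. Qed.

End Clip.

Section PlayIdentification.
Context (R : realType) (n dW : nat).
Local Notation E := (n.-tuple R).

Definition shock_index (b : 'I_n -> R) (z e : E) : E := [tuple b i * tnth z i - tnth e i | i < n].

(** The integral of [ft (shock_index b z e)] is a convolution with the normal law evaluated at
    [b z]. Equality on the dense set of indices [b z] and completeness, applied to the difference of
    the clipped functions, identify play. *)
Lemma play_identified (P : probability E R) (M : 'M[R]_n) (b : 'I_n -> R)
    (f f' : E -> E -> R) (ft ft' : E -> R) (D : set E) :
  sym_posdef M -> is_normal0 P M -> (forall i, b i != 0) -> dense_set D ->
  (forall z, measurable_fun setT (f z)) -> (forall z, measurable_fun setT (f' z)) ->
  measurable_fun setT ft -> measurable_fun setT ft' ->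
  (forall z e, 0 <= f z e <= 1) -> (forall z e, 0 <= f' z e <= 1) ->
  (forall z, D z -> [/\ {ae P, forall e, f z e = ft (shock_index b z e)},
     {ae P, forall e, f' z e = ft' (shock_index b z e)} &
     (\int[P]_e (f z e)%:E = \int[P]_e (f' z e)%:E)%E]) ->
  forall z, D z -> {ae P, forall e, f z e = f' z e}.
Proof.
move=> posM normP b0 dD mf mf' mft mft' f01 f01' Dff.
pose g v := clip (ft v) - clip (ft' v).
have mg : measurable_fun setT g by apply: measurable_funB; exact: measurable_clip.
have g1 v : `|g v| <= 1.
  have /andP[? ?] := clip_bound (ft v); have /andP[? ?] := clip_bound (ft' v).
  by rewrite /g ler_norml; apply/andP; split; lra.
have shock_indexE z e : shock_index b z e = subt [tuple b i * tnth z i | i < n] e.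
  by apply: eq_from_tnth => i; rewrite !tnth_mktuple.
have mi z : measurable_fun setT (shock_index b z).
  by rewrite (_ : shock_index b z = subt [tuple b i * tnth z i | i < n]);
    [exact: measurable_subt|apply/funext => e].
have ic (F : E -> R) z : measurable_fun setT F ->
  P.-integrable setT (EFin \o (fun e => clip (F (shock_index b z e)))).
  move=> mF; apply: measurable_bounded_integrable => //.
  - exact: le_lt_trans (probability_le1 P measurableT) (ltry _).
  - apply: measurable_clip; exact: measurableT_comp.
  - exists 1; split; first exact: num_real.
    move=> x x1 e _ /=; apply: le_trans (ltW x1).
    by have /andP[? ?] := clip_bound (F (shock_index b z e)); rewrite ger0_norm.
have same (F : E -> R) (h : E -> E -> R) z : measurable_fun setT F ->
    measurable_fun setT (h z) -> (forall e, 0 <= h z e <= 1) ->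
    {ae P, forall e, h z e = F (shock_index b z e)} ->
    \int[P]_e clip (F (shock_index b z e)) = fine (\int[P]_e (h z e)%:E)%E.
  move=> mF mh h01 hF; congr fine; apply: ae_eq_integral => //.
  - exact: measurable_int (ic _ _ mF).
  - exact/measurable_EFinP.
  - by apply: filterS hF => e he _; rewrite -he clip_id.
have zero t : {ae P, forall e, g (subt t e) = 0}.
  apply: (normal_law_complete posM normP mg g1 (dense_set_scale b0 dD)).
  move=> _ [z /Dff[fz fz' int] ->].
  under eq_Rintegral do rewrite -shock_indexE.
  rewrite RintegralB//; [|exact: ic|exact: ic].
  by rewrite (same ft f)// (same ft' f')// int subrr.
move=> z /Dff[fz fz' _]; have gz := zero [tuple b i * tnth z i | i < n].
apply: filterS3 fz fz' gz => e he he'; rewrite -shock_indexE /g -he -he' !clip_id//.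
by move=> /eqP; rewrite subr_eq0 => /eqP.
Qed.

End PlayIdentification.

(** * Discernibility *)

Theorem theorem1 (R : realType) (dI dW : nat) (hdI : (2 <= dI)%N)
    (muW : probability (dW.-tuple R) R)
    (Kz : R.-pker (dW.-tuple R) ~> (dI.-tuple R))
    (G : 'M[R]_dI -> probability (dI.-tuple R) R)
    (hG : forall M : 'M[R]_dI, sym_posdef M -> is_normal0 (G M) M)
    (S : param R dI dW -> dplay R dI dW -> Prop)
    (hS_wd : forall th h th' h', in_Theta th -> in_H h -> in_Theta th' -> in_H h' ->
       equiv_pair muW Kz G th h th' h' -> S th h -> S th' h')
    (hS_nested : forall th h, in_Theta th -> in_H h -> S th h ->
       exists th0 h0, [/\ in_Theta th0, in_H h0, equiv_pair muW Kz G th h th0 h0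
                         & S_R th0 h0]) :
  discernible muW Kz G S (Psi_R muW Kz G).
Proof.
move=> [th [h [th' [h' [Psi Psi' Sh nSh' same]]]]].
have [Th [hH [[Kfull b0] pos [ht [mht hht]] SR]]] := Psi.
have [Th' [hH' [[_ b0'] pos' [ht' [mht' hht']] SR']]] := Psi'.
(* [S] respects [equiv_pair], so it is enough to identify the pair up to that equivalence. *)
apply/nSh'/(hS_wd _ _ _ _ Th hH Th' hH' _ Sh).
have adm w : Defs.support muW w -> admissible w th h /\ admissible w th' h'.
  move=> Ww; have [pw dw] := pos w Ww; have [pw' dw'] := pos' w Ww.
  by split; split; split => // i; [exact: b0|exact: b0'].
have params w : Defs.support muW w ->
    {ae Kz w, forall z, forall y, condE G th h (z, w) y = condE G th' h' (z, w) y} ->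
    [/\ forall i y, alpha th i y w = alpha th' i y w,
        forall i, beta th i w = beta th' i w & Sigma th w = Sigma th' w].
  move=> Ww aew; have [A A'] := adm w Ww.
  have dD : dense_set (same_outcome G w th h th' h') by exact: support_dense (Kfull w Ww) aew.
  (* The inequalities for [alpha] and [Sigma] are one-sided; exchanging the two pairs gives the
     reverse ones. *)
  have dD' : dense_set (same_outcome G w th' h' th h).
    move=> c r r0; have [z Qz zc] := dD c r r0; exists z => // y; exact/esym/Qz.
  split.
  - by move=> i y; apply/eqP; rewrite eq_le (alpha_le hG A A' dD) (alpha_le hG A' A dD').
  - by move=> i; exact: (beta_identified hG A A' dD).
  - apply/matrixP => i j; have [<-|ij] := eqVneq i j.
      by have [_ [_ _ ->]] := A; have [_ [_ _ ->]] := A'.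
    by apply/eqP; rewrite eq_le (Sigma_le hG A A' dD ij) (Sigma_le hG A' A dD' ij).
split.
  apply: filterS2 (ae_support muW) same => w Ww aew.
  by have [? ? ?] := params w Ww aew.
rewrite /ae_xe /ae_x in hht hht' same *.
apply: filterS2 (filterI (ae_support muW) same) (filterI hht hht') => w [Ww aew] [aeh aeh'].
have [A A'] := adm w Ww; have [_ bE SE] := params w Ww aew.
have [pw _] := pos w Ww.
(* Both A3 representations are written with the index and the shock law of [th], which is legitimate
   because [beta] and [Sigma] already agree at [w]. *)
pose D := [set z : dI.-tuple R | [/\ forall y, condE G th h (z, w) y = condE G th' h' (z, w) y,
  {ae G (Sigma th w), forall e, forall y, h y (z, w) e = ht y w (shock_index (beta th ^~ w) z e)} &
  {ae G (Sigma th w), forall e, forall y, h' y (z, w) e = ht' y w (shock_index (beta th ^~ w) z e)}]].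
have aeD : {ae Kz w, forall z, D z}.
  apply: filterS3 aew aeh aeh' => z zz' zh zh'; split=> //.
  move: zh'; rewrite /= -SE; apply: filterS => e zh' y; rewrite zh'.
  by congr (ht' y w _); apply: eq_from_tnth => i; rewrite !tnth_mktuple bE.
have dD := support_dense (Kfull w Ww) aeD.
apply: filterS aeD => z Dz; apply: filter_forall => y.
have [_ h01 _] := hH; have [_ h01' _] := hH'.
apply: (play_identified pw (hG _ pw) (b := beta th ^~ w) (ft := ht y w) (ft' := ht' y w)
  (f := fun z => h y (z, w)) (f' := fun z => h' y (z, w)) _ dD) Dz => //.
- by move=> i; exact: b0.
- by move=> z0; exact: measurable_play.
- by move=> z0; exact: measurable_play.
- exact: (measurableT_comp (mht y) (pair1_measurable w)).
- exact: (measurableT_comp (mht' y) (pair1_measurable w)).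
- move=> z0 [zz' zh zh']; split.
  + by apply: filterS zh.
  + by apply: filterS zh'.
  + by have := zz' y; rewrite /condE /= SE.
Qed.
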